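(* There is an algorithm that, given as input a vertex-facet incidence matrix of a convex polytope $P$, computes the Hasse diagram $\mathcal{L}$ of the face lattice of $P$ in time $$O(\min\{n,m\}\cdot\alpha\cdot\varphi),$$ where $n$ is the number of vertices of $P$, $m$ is the number of facets of $P$, $\alpha$ is the number of vertex-facet incidences of $P$, and $\varphi$ is the total number of faces of $P$. The space requirements of the algorithm (without output space) can be bounded by $O(\varphi\cdot\min\{n,m\})$.
   Context: A polytope $P$ is a bounded convex polyhedron. Its set $\mathcal{F}$ of faces (including $\varnothing$ and $P$ itself), ordered by inclusion, is the face lattice of $P$, and $\varphi:=|\mathcal{F}|$. A vertex-facet incidence matrix of $P$ is a matrix $A=(a_{fv})\in\{0,1\}^{m\times n}$, with rows indexed by the facets $F=\{1,\dots,m\}$ and columns by the vertices $V=\{1,\dots,n\}$, such that $a_{fv}=1$ if facet $f$ contains vertex $v$ and $a_{fv}=0$ otherwise; $\alpha$ is the number of ones in $A$. No geometric data other than $A$ are given. The Hasse diagram $\mathcal{L}$ is the (unlabeled, abstract) directed graph whose nodes correspond to the elements of $\mathcal{F}$, with an arc $(\ell_H,\ell_G)$ between the nodes corresponding to $H,G\in\mathcal{F}$ if and only if $H\subsetneq G$ and $\dim G=\dim H+1$ (with $\dim\varnothing=-1$). Running times refer to the uniform time measure (every arithmetic operation or comparison takes one unit of time); memory requirements refer to the bit model (number of bits). The constants in the $O$-notation are absolute, and $O(f)$ means at most a constant times $\max\{1,f\}$. *)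

(* Defs.v *)
From mathcomp Require Import all_boot all_order all_algebra finmap.
From mathcomp Require Import all_classical all_reals all_analysis.

Set Implicit Arguments.
Unset Strict Implicit.
Unset Printing Implicit Defensive.

Import Order.TTheory GRing.Theory Num.Theory.
Import numFieldNormedType.Exports.

(** * Random access machines

    A RAM has finitely many registers (those named in its program), a memory
    addressed by natural numbers, and a write-only output tape.  Every register
    and memory cell holds a natural number.  Programs are written with
    structured control flow. *)

(* [Sub] is truncated; [Div] is the integer quotient, with [x %/ 0 = 0];
   comparisons return 0 or 1. *)
Inductive binop := Add | Sub | Mul | Div | Eqn | Leq.

Inductive expr :=
| Cst of nat
| Reg of nat
| Mem of expr
| Op of binop & expr & expr.

Inductive prog :=
| Assign of nat & expr
| Store of expr & expr
| Write of expr
| Seq of prog & prog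
| If of expr & prog & prog
| While of expr & prog.

(* A register or cell beyond the end of its sequence holds 0. *)
Record state := State { registers : seq nat; memory : seq nat; output : seq nat }.

Definition eval_op (o : binop) (x y : nat) : nat :=
  match o with
  | Add => x + y
  | Sub => x - y
  | Mul => x * y
  | Div => x %/ y
  | Eqn => x == y
  | Leq => x <= y
  end.

Fixpoint eval (s : state) (e : expr) : nat :=
  match e with
  | Cst c => c
  | Reg r => nth 0 (registers s) r
  | Mem a => nth 0 (memory s) (eval s a)
  | Op o e1 e2 => eval_op o (eval s e1) (eval s e2)
  end.

Fixpoint cost (e : expr) : nat :=
  match e with
  | Cst _ | Reg _ => 1
  | Mem a => (cost a).+1
  | Op _ e1 e2 => (cost e1 + cost e2).+1
  end.

(* Number of binary digits; [bitlen 0 = 1]. *)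
Definition bitlen (x : nat) : nat := (trunc_log 2 x).+1.

(* All cells up to the largest address written so far are counted, so that no
   information can be hidden in the choice of the addresses.  The output is
   not counted. *)
Definition bits (s : state) : nat :=
  \sum_(x <- registers s) bitlen x + \sum_(x <- memory s) bitlen x.

Definition set_reg (s : state) (r x : nat) : state :=
  State (set_nth 0 (registers s) r x) (memory s) (output s).

Definition set_mem (s : state) (a x : nat) : state :=
  State (registers s) (set_nth 0 (memory s) a x) (output s).

Definition write (s : state) (x : nat) : state :=
  State (registers s) (memory s) (rcons (output s) x).

(* [exec p s t b s']: started in state [s], the program [p] halts in state
   [s'] after [t] time units (uniform measure), and [b] is the maximum of
   [bits] over all states it goes through. *)
Inductive exec : prog -> state -> nat -> nat -> state -> Prop :=
| ExecAssign s r e (s' := set_reg s r (eval s e)) :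
    exec (Assign r e) s (cost e).+1 (maxn (bits s) (bits s')) s'
| ExecStore s a e (s' := set_mem s (eval s a) (eval s e)) :
    exec (Store a e) s (cost a + cost e).+1 (maxn (bits s) (bits s')) s'
| ExecWrite s e :
    exec (Write e) s (cost e).+1 (bits s) (write s (eval s e))
| ExecSeq p1 p2 s1 s2 s3 t1 t2 b1 b2 :
    exec p1 s1 t1 b1 s2 -> exec p2 s2 t2 b2 s3 ->
    exec (Seq p1 p2) s1 (t1 + t2) (maxn b1 b2) s3
| ExecIfTrue e p1 p2 s t b s' :
    eval s e != 0 -> exec p1 s t b s' ->
    exec (If e p1 p2) s ((cost e).+1 + t) b s'
| ExecIfFalse e p1 p2 s t b s' :
    eval s e = 0 -> exec p2 s t b s' ->
    exec (If e p1 p2) s ((cost e).+1 + t) b s'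
| ExecWhileTrue e p s1 s2 s3 t1 t2 b1 b2 :
    eval s1 e != 0 -> exec p s1 t1 b1 s2 -> exec (While e p) s2 t2 b2 s3 ->
    exec (While e p) s1 ((cost e).+1 + t1 + t2) (maxn b1 b2) s3
| ExecWhileFalse e p s :
    eval s e = 0 -> exec (While e p) s (cost e).+1 (bits s) s.

(* The input is in memory, hence counted by [bits]: m, n, then the m * n
   entries of the matrix row by row. *)
Definition input_state m n (A : 'M[bool]_(m, n)) : state :=
  State [::]
        [:: m, n & [seq nat_of_bool (A i j) | i <- enum 'I_m, j <- enum 'I_n]]
        [::].

(* A directed graph on 'I_N is output as the list of its arcs, each one as
   two consecutive numbers, followed by N (which thus need not be known before
   the arcs are output). *)
Definition encode_digraph N (arcs : seq ('I_N * 'I_N)) : seq nat :=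
  rcons (flatten [seq [:: val a.1; val a.2] | a <- arcs]) N.

(** * Polytopes *)

Local Open Scope classical_set_scope.
Local Open Scope ring_scope.

Section Polytopes.
Variables (R : realType) (d : nat).
Implicit Types (S P F G H : set 'cV[R]_d).

Definition polyhedron P :=
  exists (k : nat) (M : 'M[R]_(k, d)) (b : 'cV[R]_k),
    P = [set x | forall i, (M *m x) i 0 <= b i 0].

Definition polytope P := polyhedron P /\ bounded_set P.

Definition affinely_independent k (p : 'I_k -> 'cV[R]_d) :=
  forall l : 'I_k -> R,
    \sum_i l i = 0 -> \sum_i l i *: p i = 0 -> forall i, l i = 0.

(* One less than the maximal number of affinely independent points of S (at
   most d + 1 of them exist), so that [dim set0 = -1]. *)
Definition dim S : int :=
  (\max_(k < d.+2 | `[< exists p : 'I_k -> 'cV[R]_d,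
      (forall i, S (p i)) /\ affinely_independent p >]) k)%N%:Z - 1.

(* The choices a = 0, c = 1 and a = 0, c = 0 give the faces set0 and P. *)
Definition is_face P F :=
  exists (a : 'rV[R]_d) (c : R),
    (forall x, P x -> (a *m x) 0 0 <= c) /\
    F = P `&` [set x | (a *m x) 0 0 = c].

Definition faces P : set (set 'cV[R]_d) := [set F | is_face P F].

Definition vertices P := [set F | faces P F /\ dim F = 0].

Definition facets P := [set F | faces P F /\ dim F = dim P - 1].

Definition nfaces P : nat := #|` fset_set (faces P)|%fset.

Definition vertex_facet_incidence m n P (A : 'M[bool]_(m, n)) :=
  exists (fac : 'I_m -> set 'cV[R]_d) (vert : 'I_n -> set 'cV[R]_d),
    [/\ set_bij [set: 'I_m] (facets P) fac,
        set_bij [set: 'I_n] (vertices P) vert &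
        forall f v, A f v <-> vert v `<=` fac f].

Definition hasse_arc H G := H `<` G /\ dim G = dim H + 1.

Definition is_hasse_diagram P N (arcs : seq ('I_N * 'I_N)) :=
  uniq arcs /\
  exists face : 'I_N -> set 'cV[R]_d,
    set_bij [set: 'I_N] (faces P) face /\
    forall i j, (i, j) \in arcs <-> hasse_arc (face i) (face j).

End Polytopes.

Definition nincidences m n (A : 'M[bool]_(m, n)) : nat :=
  (\sum_(i < m) \sum_(j < n) A i j)%N.

(* Main.v *)
Require Import Defs.
From mathcomp Require Import all_boot all_order all_algebra finmap.
From mathcomp Require Import all_classical all_reals all_analysis.
From mathcomp Require Import zify lra.

(* Mapping a face to its set of vertices, or to the set of facets containing it,
   identifies the face lattice with the lattice of closed sets of the incidence
   matrix or of its transpose; it is therefore enough to compute the cover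
   relation of the closed sets of a matrix with r rows and c <= r columns.  The
   covers of a closed set H are the minimal closures of H + v for v outside H.
   All c closures together cost O(c * alpha): every row containing H and v is
   intersected once with the candidate for v.  The faces are the nodes of a
   digital search tree keyed by the sets, packed as c-bit numbers: a lookup takes
   at most c steps, and as phi <= 2^c every cell of the tree has O(c) bits.

   On the geometric side, for P = {x | Mx <= b} the nonempty faces are the sets
   of points of P at which all the constraints tight at a given x are tight.
   Moving along a line until a new constraint becomes tight yields new faces.
   This shows that faces are determined by their vertices and by their facets,
   and that the dimension increases by one along every cover. *)

Set Implicit Arguments.
Unset Strict Implicit.
Unset Printing Implicit Defensive.

Import Order.TTheory GRing.Theory Num.Theory.
Import numFieldNormedType.Exports.

(** * Execution of programs *)

(** The space bound shapes the machine side: [bits] counts the input, the registers and every cell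
    up to the last address used. The input fits because facets and vertices are faces, so both sides
    of the matrix are at most [phi]. Cells get individual widths, whereas the 18 registers, being of
    fixed number, may take [O(phi * c)] bits each; their width [W] is linear in the memory size, and
    [2 ^ W] exceeds every number in them without any logarithm being estimated. In the time bound,
    clearing and searching cost [c * c] per face and testing the rows [r * c]. Both are absorbed by
    [c * alpha] because [r <= alpha]. This fails only for a point, whose single facet is the empty
    face and for which [alpha = 0]; there everything is constant. The exploration starts from the
    empty set, closed in both orientations: it stands for the empty face when the columns are
    vertices, and for the polytope itself when they are facets, in which case the arcs are emitted
    reversed. *)

Local Notation eval := Defs.eval.
Local Notation set_mem := Defs.set_mem.

Section Execution.
Variables (W Z : nat) (beta : nat -> nat).
Implicit Types (s : state) (p : prog) (e : expr) (Q : state -> Prop).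

Definition nregs := 18.

(** One width per address and a common one for the registers make the space of a whole run a static
    number, [space]. A uniform cell width would lose the bound, since matrix entries take one bit
    and tree cells [c]. *)
Definition fits s := [/\ size (registers s) <= nregs,
  forall r, nth 0 (registers s) r < 2 ^ W,
  size (memory s) <= Z & forall a, nth 0 (memory s) a < 2 ^ beta a].

Definition space := nregs * W.+1 + \sum_(a < Z) (beta a).+1.

Lemma bitlen_le x k : x < 2 ^ k -> bitlen x <= k.+1.
Proof.
rewrite /bitlen ltnS; case: x => [|x] h; first by rewrite trunc_log0.
by rewrite -(leq_exp2l (m := 2)) //; apply: leq_trans (trunc_logP _ _) (ltnW h).
Qed.

Lemma sum_bitlen_le (l : seq nat) N (f : nat -> nat) : size l <= N ->
  (forall i, nth 0 l i < 2 ^ f i) -> \sum_(x <- l) bitlen x <= \sum_(i < N) (f i).+1.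
Proof.
move=> lN lf; rewrite (big_nth 0) big_mkord.
rewrite (big_ord_widen N (fun i => bitlen (nth 0 l i))) //.
by rewrite big_mkcond leq_sum // => i _; case: ifP => // _; exact: bitlen_le.
Qed.

Lemma bits_fits s : fits s -> bits s <= space.
Proof.
move=> [sr hr sm hm]; rewrite /bits leq_add //; last exact: sum_bitlen_le.
apply: leq_trans (sum_bitlen_le (f := fun _ => W) sr hr) _.
by rewrite sum_nat_const card_ord.
Qed.

(** Total correctness in the style of Hoare logic; [T] is only an upper bound, so that costs can be
    rounded up whenever rules are composed. *)
Definition runs p s T Q := exists t b s', [/\ exec p s t b s', t <= T, b <= space, fits s' & Q s'].

Lemma runs_le p s T T' Q Q' : runs p s T Q -> T <= T' -> (forall s', fits s' -> Q s' -> Q' s') ->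
  runs p s T' Q'.
Proof.
move=> [t [b [s' [e1 tT bB fs Qs]]]] TT QQ; exists t, b, s'; split=> //; last exact: QQ.
exact: leq_trans tT TT.
Qed.

Lemma fits_set_reg s r x : fits s -> r < nregs -> x < 2 ^ W -> fits (set_reg s r x).
Proof.
move=> [sr hr sm hm] rn xW; split=> //=.
  by rewrite size_set_nth geq_max rn.
by move=> r'; rewrite nth_set_nth /=; case: eqP.
Qed.

Lemma fits_set_mem s a x : fits s -> a < Z -> x < 2 ^ beta a -> fits (set_mem s a x).
Proof.
move=> [sr hr sm hm] aZ xb; split=> //=.
  by rewrite size_set_nth geq_max aZ.
by move=> a'; rewrite nth_set_nth /=; case: eqP => // ->.
Qed.

Lemma runs_assign r e s Q : fits s -> r < nregs -> eval s e < 2 ^ W ->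
  Q (set_reg s r (eval s e)) -> runs (Assign r e) s (cost e).+1 Q.
Proof.
move=> fs rn eW Qs; have fs' := fits_set_reg fs rn eW.
exists (cost e).+1, (maxn (bits s) (bits (set_reg s r (eval s e)))), (set_reg s r (eval s e)); split=> //.
  exact: ExecAssign.
by rewrite geq_max !bits_fits.
Qed.

Lemma runs_store a e s Q : fits s -> eval s a < Z -> eval s e < 2 ^ beta (eval s a) ->
  Q (set_mem s (eval s a) (eval s e)) -> runs (Store a e) s (cost a + cost e).+1 Q.
Proof.
move=> fs aZ eb Qs; have fs' := fits_set_mem fs aZ eb.
exists (cost a + cost e).+1, (maxn (bits s) (bits (set_mem s (eval s a) (eval s e)))),
  (set_mem s (eval s a) (eval s e)); split=> //.
  exact: ExecStore.
by rewrite geq_max !bits_fits.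
Qed.

Lemma runs_write e s Q : fits s -> Q (write s (eval s e)) -> runs (Write e) s (cost e).+1 Q.
Proof.
move=> fs Qs; exists (cost e).+1, (bits s), (write s (eval s e)); split=> //.
  exact: ExecWrite.
exact: bits_fits.
Qed.

Lemma runs_seq p1 p2 s T1 T2 Q1 Q : runs p1 s T1 Q1 ->
  (forall s', fits s' -> Q1 s' -> runs p2 s' T2 Q) -> runs (Seq p1 p2) s (T1 + T2) Q.
Proof.
move=> [t1 [b1 [s1 [x1 tT1 bB1 fs1 Qs1]]]] /(_ _ fs1 Qs1)[t2 [b2 [s2 [x2 tT2 bB2 fs2 Qs2]]]].
exists (t1 + t2), (maxn b1 b2), s2; split=> //; first exact: ExecSeq x1 x2.
  exact: leq_add.
by rewrite geq_max bB1.
Qed.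

Lemma runs_if e p1 p2 s T Q :
  (eval s e != 0 -> runs p1 s T Q) -> (eval s e = 0 -> runs p2 s T Q) ->
  runs (If e p1 p2) s ((cost e).+1 + T) Q.
Proof.
move=> h1 h2; have [e0|e0] := eqVneq (eval s e) 0.
  have [t [b [s' [x tT bB fs Qs]]]] := h2 e0.
  exists ((cost e).+1 + t), b, s'; split=> //; first exact: ExecIfFalse.
  by rewrite leq_add2l.
have [t [b [s' [x tT bB fs Qs]]]] := h1 e0.
exists ((cost e).+1 + t), b, s'; split=> //; first exact: ExecIfTrue.
by rewrite leq_add2l.
Qed.

(** Termination comes from the guard forcing [i < n]. The exit index [j] is left open because the
    tree search may stop before [n] iterations. *)
Lemma runs_while e p n (I : nat -> state -> Prop) (T : nat -> nat) :
  (forall i s, fits s -> I i s -> eval s e != 0 -> i < n /\ runs p s (T i) (I i.+1)) ->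
  forall i s, fits s -> i <= n -> I i s ->
  runs (While e p) s (\sum_(i <= j < n) ((cost e).+1 + T j) + (cost e).+1)
    (fun s' => exists j, [/\ j <= n, I j s' & eval s' e = 0]).
Proof.
move=> step i; have [k] := ubnP (n - i); elim: k i => // k IHk i; rewrite ltnS => nik s fs iln Is.
have [e0|e0] := eqVneq (eval s e) 0.
  exists (cost e).+1, (bits s), s; split=> //.
  - exact: ExecWhileFalse.
  - exact: leq_addl.
  - exact: bits_fits.
  - by exists i.
have [iltn [t1 [b1 [s1 [x1 tT1 bB1 fs1 Is1]]]]] := step i s fs Is e0.
have [|t2 [b2 [s2 [x2 tT2 bB2 fs2 Qs2]]]] := IHk i.+1 _ s1 fs1 iltn Is1; first by lia.
exists ((cost e).+1 + t1 + t2), (maxn b1 b2), s2; split=> //.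
- exact: ExecWhileTrue x1 x2.
- rewrite big_ltn //; lia.
- by rewrite geq_max bB1.
Qed.


Lemma runs_leT p s T T' Q : runs p s T Q -> T <= T' -> runs p s T' Q.
Proof. by move=> h TT; exact: runs_le h TT _. Qed.

Lemma runs_assign_seq r e p s T Q : fits s -> r < nregs -> eval s e < 2 ^ W ->
  (fits (set_reg s r (eval s e)) -> runs p (set_reg s r (eval s e)) T Q) ->
  runs (Seq (Assign r e) p) s ((cost e).+1 + T) Q.
Proof.
move=> fs rn eW h.
apply: (runs_seq (Q1 := fun s' => s' = set_reg s r (eval s e))); first exact: runs_assign.
by move=> s' fs' E; rewrite E in fs' *; exact: h.
Qed.

Lemma runs_store_seq a e p s T Q : fits s -> eval s a < Z -> eval s e < 2 ^ beta (eval s a) ->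
  (fits (set_mem s (eval s a) (eval s e)) -> runs p (set_mem s (eval s a) (eval s e)) T Q) ->
  runs (Seq (Store a e) p) s ((cost a + cost e).+1 + T) Q.
Proof.
move=> fs aZ eb h.
apply: (runs_seq (Q1 := fun s' => s' = set_mem s (eval s a) (eval s e))); first exact: runs_store.
by move=> s' fs' E; rewrite E in fs' *; exact: h.
Qed.

Definition for_loop i bound p :=
  Seq (Assign i (Cst 0)) (While (Op Leq (Op Add (Reg i) (Cst 1)) bound)
    (Seq p (Assign i (Op Add (Reg i) (Cst 1))))).

Lemma runs_for i bound p n (I : nat -> state -> Prop) (T : 'I_n -> nat) s :
  fits s -> i < nregs -> n < 2 ^ W -> I 0 (set_reg s i 0) ->
  (forall k s, I k s -> nth 0 (registers s) i = k /\ eval s bound = n) ->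
  (forall (k : 'I_n) s, fits s -> I k s ->
     runs p s (T k) (fun s' => nth 0 (registers s') i = k /\ I k.+1 (set_reg s' i k.+1))) ->
  runs (for_loop i bound p) s
    (\sum_(k < n) (cost bound + 10 + T k) + (cost bound + 10)) (I n).
Proof.
(* [runs_while] expects a time for every natural number: [T] is extended by 0 outside the range of
   the sum. *)
move=> fs ir nW I0 reg step; pose T' k := if insub k is Some k' then T k' else 0.
eapply runs_leT.
  eapply runs_assign_seq => //=; first by rewrite expn_gt0.
  move=> fs0.
  eapply runs_le; [|exact: leqnn|].
    eapply (runs_while (I := I) (T := fun j => T' j + 4) (n := n)); [|exact: fs0|exact: leq0n|exact: I0].
    move=> k s' fs' Ik.
  rewrite /=; have [-> ->] := reg _ _ Ik; rewrite addn1 eqb0 negbK => kn; split=> //.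
    rewrite /T' insubT /=.
    apply: runs_seq (step (Ordinal kn) s' fs' Ik) _ => s1 fs1 [r1 I1].
    have E : eval s1 (Op Add (Reg i) (Cst 1)) = k.+1 by rewrite /= r1 addn1.
    apply: runs_assign => //; rewrite E //.
    exact: leq_ltn_trans nW.
  move=> s' fs' [j [jn Ij]] /=; have [-> ->] := reg _ _ Ij.
  move=> E; have {}E : (j + 1 <= n) = false by move: E; case: (_ <= _).
  by suff <- : j = n by []; lia.
rewrite big_mkord /=.
have -> : \sum_(k < n) ((3 + cost bound).+2 + (T' k + 4)) =
    \sum_(k < n) (cost bound + 9 + T k).
  by apply: eq_bigr => k _; rewrite /T' valK; lia.
have : \sum_(k < n) (cost bound + 9 + T k) <= \sum_(k < n) (cost bound + 10 + T k).
  by apply: leq_sum => k _; lia.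
set u := \sum_(k < n) (cost bound + 9 + T k); set v := \sum_(k < n) (cost bound + 10 + T k).
move: u v (cost bound) => u v b; lia.
Qed.

End Execution.

(** * Closed sets of a 0/1 matrix *)

Section ClosedSets.
Variables (r c : nat) (B : 'M[bool]_(r, c)).
Implicit Types S T U : {set 'I_c}.

Definition in_row (f : 'I_r) S := [forall u in S, B f u].

(** The intersection of the rows containing [S], and all columns if there are none. With facets as
    rows and vertices as columns it is the vertex set of the smallest face through [S]. *)
Definition cl S : {set 'I_c} := [set w | [forall (f | in_row f S), B f w]].

Definition closed_set S := cl S == S.

Definition closed_cover S T := S \proper T /\
  forall U, closed_set U -> S \subset U -> U \subset T -> U = S \/ U = T.

Lemma in_rowP f S : reflect {in S, forall u, B f u} (in_row f S).
Proof. exact: forall_inP. Qed.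

Lemma clP S w : reflect (forall f, in_row f S -> B f w) (w \in cl S).
Proof. by rewrite inE; exact: forall_inP. Qed.

Lemma sub_cl S : S \subset cl S.
Proof. by apply/fintype.subsetP => w Sw; apply/clP => f /in_rowP; apply. Qed.

Lemma in_row_cl f S : in_row f (cl S) = in_row f S.
Proof.
apply/in_rowP/in_rowP => h u Su; last by move/clP: Su; apply; exact/in_rowP.
exact/h/(fintype.subsetP (sub_cl S)).
Qed.

Lemma clK S : closed_set (cl S).
Proof.
by apply/eqP/finset.setP => w; rewrite !inE; apply: eq_forallb => f; rewrite in_row_cl.
Qed.

Lemma cl_min S T : closed_set T -> S \subset T -> cl S \subset T.
Proof.
move=> /eqP <- /fintype.subsetP ST; apply/fintype.subsetP => w /clP h; apply/clP => f fT.
by apply: h; apply/in_rowP => u /ST; move/clP; apply.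
Qed.


(** * Covers of a closed set *)

Definition cl1 S v := cl (v |: S).

(** Separating the condition on [S] from that on [v] lets all closures be computed together: a row
    is compared with [S] once and then cuts down the candidates of its own elements. *)
Lemma cl1P S v w : reflect (forall f, in_row f S -> B f v -> B f w) (w \in cl1 S v).
Proof.
apply: (iffP (clP _ _)) => h f.
  by move=> /in_rowP fS fv; apply: h; apply/in_rowP => u; rewrite !inE => /predU1P[->//|/fS].
move=> /in_rowP fS; apply: h; last by rewrite fS // setU11.
by apply/in_rowP => u uS; rewrite fS // inE uS orbT.
Qed.

Lemma sub_cl1 S v : S \subset cl1 S v.
Proof. by apply: fintype.subset_trans (sub_cl _); exact: finset.subsetUr. Qed.

Lemma mem_cl1 S v : v \in cl1 S v.
Proof. by apply: (fintype.subsetP (sub_cl _)); rewrite setU11. Qed.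

Lemma cl1_min S T v : closed_set T -> S \subset T -> v \in T -> cl1 S v \subset T.
Proof. by move=> cT ST vT; apply: cl_min cT _; rewrite finset.subUset finset.sub1set vT. Qed.

Lemma cl1_closed S v : closed_set (cl1 S v).
Proof. exact: clK. Qed.

(* The test made by the program: [cl1 S v] covers [S] and [v] is the least
   element that [cl1 S v] adds to [S]. *)
Definition selects S v := [forall w in cl1 S v,
  if w \in S then w != v else (v <= w) && (v \in cl1 S w)].

(** A closed [U] between [S] and [cl1 S v] with an element [w] outside [S] contains [cl1 S w], hence
    [v] by the test, hence all of [cl1 S v]. Requiring [v] to be the least new element leaves one
    generator per cover. *)
Lemma selectsP S v : closed_set S ->
  reflect [/\ v \notin S, closed_cover S (cl1 S v) &
              forall w, w \in cl1 S v -> w \notin S -> v <= w] (selects S v).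
Proof.
move=> cS; apply: (iffP forall_inP) => [h|[vS [SC cov] vmin] w wC].
  have vS : v \notin S by have := h v (mem_cl1 S v); case: ifP => // _; rewrite eqxx.
  split=> //; last by move=> w wC wS; have := h w wC; rewrite (negPf wS) => /andP[].
  split; first by apply/properP; split; [exact: sub_cl1|exists v; rewrite ?mem_cl1].
  move=> U cU SU UC; have [|US] := boolP (U \subset S); first by left; apply/eqP; rewrite finset.eqEsubset SU andbT.
  right; apply/eqP; rewrite finset.eqEsubset UC.
  have [w wU wS] := fintype.subsetPn US.
  have := h w (fintype.subsetP UC w wU); rewrite (negPf wS) => /andP[_ vw].
  by apply: cl1_min => //; apply: (fintype.subsetP (cl1_min cU SU wU)).
case: ifPn => wS; first by apply: contraTneq wS => ->.
rewrite vmin ?wS //=.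
have [|E|->] := cov (cl1 S w) (cl1_closed _ _) (sub_cl1 _ _); last exact: mem_cl1.
  exact: cl1_min (cl1_closed _ _) (sub_cl1 _ _) wC.
by have := mem_cl1 S w; rewrite E (negPf wS).
Qed.

Lemma cover_selects S T : closed_set S -> closed_set T -> closed_cover S T ->
  exists2 v, selects S v & T = cl1 S v.
Proof.
move=> cS cT [ST cov].
have [_ [v0 v0T v0S]] := properP ST.
have v0P : (v0 \in T) && (v0 \notin S) by rewrite v0T.
(* Every element of [T] outside [S] generates the cover [T]; the least one passes the test. *)
case: (@arg_minnP _ v0 [pred v | (v \in T) && (v \notin S)] (fun v => v : nat) v0P).
move=> v /= /andP[vT vS] vmin.
have CT : cl1 S v \subset T by apply: cl1_min => //; exact: proper_sub.
have E : T = cl1 S v.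
  have [|E|->//] := cov (cl1 S v) (cl1_closed _ _) (sub_cl1 _ _); first exact: CT.
  by have := mem_cl1 S v; rewrite E (negPf vS).
exists v => //; apply/selectsP; rewrite -?E => //; split=> // w wT wS.
by apply: vmin; rewrite wT.
Qed.

Lemma selects_inj S v w : closed_set S -> selects S v -> selects S w ->
  cl1 S v = cl1 S w -> v = w.
Proof.
move=> cS /(selectsP _ cS)[vS _ vmin] /(selectsP _ cS)[wS _ wmin] E.
apply/val_inj/eqP; rewrite eqn_leq vmin ?wmin //; first by rewrite -E mem_cl1.
by rewrite E mem_cl1.
Qed.

(** * Exploration in order of discovery *)

Definition visit q (st : seq {set 'I_c} * seq (nat * nat)) v :=
  let S := nth finset.set0 st.1 q in
  let T := cl1 S v in
  if selects S v then
    (if T \in st.1 then st.1 else rcons st.1 T, rcons st.2 (q, index T st.1))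
  else st.

Definition visits q v st := foldl (visit q) st (take v (enum 'I_c)).

Lemma visitsS q (v : 'I_c) st : visits q v.+1 st = visit q (visits q v st) v.
Proof.
rewrite /visits (take_nth v) ?size_enum_ord //.
by rewrite -cats1 foldl_cat /= nth_ord_enum.
Qed.

(** The list of sets found doubles as the queue: stage [q] treats its entry number [q], and the
    search is complete once [q] is the length of the list. *)
Fixpoint explore q := if q is q'.+1 then visits q' c (explore q') else ([:: finset.set0], [::]).

Definition visited q v (i : nat) (u : 'I_c) := (i < q) || ((i == q) && (u < v)).

(** Soundness and completeness of the arcs with respect to the pairs [(i, u)] that precede [(q, v)]
    lexicographically; in this form one invariant serves both nested loops. *)
Definition explored q v (st : seq {set 'I_c} * seq (nat * nat)) := let: (Ss, arcs) := st in
  [/\ uniq Ss /\ finset.set0 \in Ss, {in Ss, forall S, closed_set S}, uniq arcs,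
     forall i j, (i, j) \in arcs -> [/\ i < size Ss, j < size Ss &
       exists u, [/\ visited q v i u, selects (nth finset.set0 Ss i) u &
         nth finset.set0 Ss j = cl1 (nth finset.set0 Ss i) u]] &
     forall i u, i < size Ss -> visited q v i u -> selects (nth finset.set0 Ss i) u ->
       exists2 j, (i, j) \in arcs & nth finset.set0 Ss j = cl1 (nth finset.set0 Ss i) u].

Lemma explored_visit q (v : 'I_c) st : q < size st.1 -> explored q v st -> explored q v.+1 (visit q st v).
Proof.
case: st => Ss arcs /= qs [[uS S0] cS uA snd cpl]; rewrite /visit /=.
have visS i u : visited q v.+1 i u = visited q v i u || ((i == q) && (u == v)).
  have -> : (u == v) = (val u == v) by [].
  by rewrite /visited ltnS [_ <= v]leq_eqVlt; case: (i == q); rewrite /= ?orbF // -orbA [_ || (u < v)]orbC.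
have Sq : nth finset.set0 Ss q \in Ss by exact: mem_nth.
set S := nth _ Ss q in Sq *; set T := cl1 S v.
case: ifP => [sel|nsel]; last first.
  split=> //.
    move=> i j /snd[iS jS [u [vis su E]]]; split=> //; exists u; split=> //.
    by rewrite visS vis.
  move=> i u iS; rewrite visS => /orP[|/andP[/eqP-> /eqP->]]; first exact: cpl.
  by rewrite -/S nsel.
set Ss' := if _ then _ else _; set k := index T Ss.
have TS' : T \in Ss' by rewrite /Ss'; case: ifP => // _; rewrite mem_rcons mem_head.
have sub i : i < size Ss -> i < size Ss' /\ nth finset.set0 Ss' i = nth finset.set0 Ss i.
  rewrite /Ss'; case: ifP => // _ iS; rewrite size_rcons nth_rcons iS; split=> //; exact: ltnW.
(* [index] refers to the old list: for a new [T] it is the length of that list, which is the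
   position [T] receives. *)
have kS : k < size Ss' /\ nth finset.set0 Ss' k = T.
  rewrite /Ss' /k; case: ifP => TS; first by rewrite index_mem TS nth_index.
  by rewrite size_rcons ltnS index_size nth_rcons ltnNge memNindex ?TS // leqnn /= eqxx.
have mS' U : U \in Ss' -> U \in Ss \/ U = T.
  rewrite /Ss'; case: ifP => _; first by left.
  by rewrite mem_rcons inE => /predU1P[]; [right|left].
split.
- split; first by rewrite /Ss'; case: ifP => // TS; rewrite rcons_uniq TS.
  by rewrite /Ss'; case: ifP => // TS; rewrite mem_rcons inE S0 orbT.
- by move=> U /mS'[/cS//|->]; exact: cl1_closed.
(* The same arc recorded earlier would come from some [u] with the same closure; by [selects_inj]
   this is [v], which has not been visited yet. *)
- rewrite rcons_uniq uA andbT; apply/negP => /snd[_ kS1 [u [vis su E]]].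
  have uv : u = v.
    apply: (selects_inj (cS _ Sq)) => //; rewrite -/S in E; rewrite -E.
    by have [_ <-] := sub _ kS1; case: kS.
  by move: vis; rewrite /visited uv ltnn eqxx ltnn.
- move=> i j; rewrite mem_rcons inE => /predU1P[[-> ->]|].
    have [q1 q2] := sub _ qs; split=> //; first by case: kS.
    by exists v; rewrite visS !eqxx orbT q2 -/S; case: kS => _ ->.
  move=> /snd[/sub[i1 i2] /sub[j1 j2] [u [vis su E]]]; split=> //; exists u.
  by rewrite i2 j2 visS vis.
(* A set appended just now has an index beyond [q], so none of its pairs counts as visited. *)
move=> i u; have [iS|iS] := ltnP i (size Ss); last first.
  have nq : (i == q) = false by apply/negbTE; rewrite neq_ltn (leq_trans qs iS) orbT.
  rewrite visS /visited nq /= !orbF => _ iq; have := ltn_trans iq qs; rewrite ltnNge iS.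
  by [].
have [_ ->] := sub _ iS; rewrite visS => _ /orP[vis|/andP[/eqP-> /eqP->]] su.
  have [j jA jE] := cpl _ _ iS vis su; exists j; first by rewrite mem_rcons inE jA orbT.
  by have [_ /sub[_ ->] _] := snd _ _ jA.
by exists k; [rewrite mem_rcons mem_head|case: kS].
Qed.

Lemma size_visit q st v : size st.1 <= size (visit q st v).1.
Proof. by rewrite /visit; case: ifP => //= _; case: ifP; rewrite ?size_rcons. Qed.

Lemma explored_visits q v st : v <= c -> q < size st.1 -> explored q 0 st ->
  explored q v (visits q v st) /\ size st.1 <= size (visits q v st).1.
Proof.
move=> + qs e0; elim: v => [|v IHv] vc; first by rewrite /visits take0.
have [e1 s1] := IHv (ltnW vc); rewrite (visitsS q (Ordinal vc)); split.
  exact: (explored_visit (v := Ordinal vc)) (leq_trans qs s1) e1.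
exact: leq_trans s1 (size_visit _ _ _).
Qed.

Lemma explored_next q st : explored q c st -> explored q.+1 0 st.
Proof.
case: st => Ss arcs [h1 h2 h3 h4 h5].
have E i (u : 'I_c) : visited q.+1 0 i u = visited q c i u.
  by rewrite /visited ltn0 andbF orbF ltnS leq_eqVlt ltn_ord andbT orbC.
split=> // [i j /h4[? ? [u uP]]|i u iS]; last by rewrite E; exact: h5.
by split=> //; exists u; rewrite E.
Qed.

Lemma explored_explore q : (forall i, i < q -> i < size (explore i).1) -> closed_set finset.set0 ->
  explored q 0 (explore q).
Proof.
move=> + c0; elim: q => [|q IHq] qs.
  split=> //; first by split; rewrite ?inE.
  - by move=> S; rewrite inE => /eqP ->.
  by move=> [|i] u //= _; rewrite /visited ltn0 andbF.
have [|e1 _] := @explored_visits q c (explore q) (leqnn _) (qs _ (ltnSn q)).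
  by apply: IHq => i iq; apply: qs; exact: ltnW.
exact: explored_next.
Qed.

(** Induction on the size: a nonempty closed [T] covers a largest closed proper subset [S], which is
    listed by induction. As every listed set has been treated, the cover [T] of [S] was found. *)
Lemma explored_closed q st : explored q 0 st -> size st.1 = q ->
  {in [pred S | closed_set S], forall S, S \in st.1}.
Proof.
case: st => Ss arcs /= [[uS S0] cS uA snd cpl] sq T.
have [k] := ubnP #|T|; elim: k T => // k IHk T; rewrite ltnS inE => Tk cT.
have [->//|T0] := eqVneq T finset.set0.
have P0 : closed_set finset.set0 && (finset.set0 \proper T) by rewrite cS // finset.proper0.
case: (@arg_maxnP _ finset.set0 [pred S : {set 'I_c} | closed_set S && (S \proper T)] (fun S => #|S|) P0).
move=> S /= /andP[cS1 ST] Smax.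
have SS : S \in Ss by apply: IHk => //; exact: leq_trans (proper_card ST) Tk.
have [|v sv Tv] := cover_selects cS1 cT.
  split=> // U cU SU UT; have [->|UT'] := eqVneq U T; [by right|left].
  apply/esym/eqP; rewrite eqEcard SU; apply: Smax; rewrite /= cU.
  by rewrite finset.properEneq UT'.
have iS : index S Ss < size Ss by rewrite index_mem.
have [||j jA jE] := cpl (index S Ss) v iS; rewrite ?nth_index //.
  by rewrite /visited -sq iS.
by rewrite Tv -{1}(nth_index finset.set0 SS) -jE mem_nth //; have [] := snd _ _ jA.
Qed.

Lemma explored_arcs q st i j : explored q 0 st -> size st.1 = q ->
  reflect [/\ i < q, j < q & closed_cover (nth finset.set0 st.1 i) (nth finset.set0 st.1 j)]
    ((i, j) \in st.2).
Proof.
case: st => Ss arcs /= [[uS S0] cS uA snd cpl] sq; apply: (iffP idP).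
  move=> /snd[iS jS [u [_ su ->]]]; rewrite -sq; split=> //.
  by have [] := selectsP _ (cS _ (mem_nth _ iS)) su.
move=> [iq jq cov]; rewrite -sq in iq jq.
have [u su E] := cover_selects (cS _ (mem_nth _ iq)) (cS _ (mem_nth _ jq)) cov.
have [|j' jA jE] := cpl i u iq _ su; first by rewrite /visited -sq iq.
have [_ jS' _] := snd _ _ jA.
suff <- : j' = j by [].
by apply/eqP; rewrite -(nth_uniq finset.set0 jS' jq uS) jE E.
Qed.

End ClosedSets.

(** * Packed sets and digital search trees *)

Definition bit x w := odd (x %/ 2 ^ w).

Lemma modn_exp2S x t : x %% 2 ^ t.+1 = bit x t * 2 ^ t + x %% 2 ^ t.
Proof.
have xE : x = (x %/ 2 ^ t)./2 * 2 ^ t.+1 + (bit x t * 2 ^ t + x %% 2 ^ t).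
  rewrite addnA expnS mulnA muln2 -mulnDl [_.*2 + _]addnC odd_double_half.
  exact: divn_eq.
rewrite {1}xE modnMDl modn_small // expnS mul2n -addnn.
rewrite -addnS leq_add ?ltn_mod ?expn_gt0 //.
by rewrite -[leqRHS]mul1n leq_mul // leq_b1.
Qed.

Definition num (f : nat -> bool) n := \sum_(i < n) f i * 2 ^ i.

Lemma numS f n : num f n.+1 = num f n + f n * 2 ^ n.
Proof. by rewrite /num big_ord_recr. Qed.

Lemma num_lt f n : num f n < 2 ^ n.
Proof.
elim: n => [|n IHn]; first by rewrite /num big_ord0.
rewrite numS expnS mul2n -addnn -addSn leq_add //.
by rewrite -[leqRHS]mul1n leq_mul // leq_b1.
Qed.

Lemma bit_num f n w : w < n -> bit (num f n) w = f w.
Proof.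
elim: n => // n IHn; rewrite ltnS leq_eqVlt numS /bit => /predU1P[->|wn].
  by rewrite addnC divnMDl ?expn_gt0 // divn_small ?num_lt // addn0 oddb.
rewrite -(subnK wn) addnS -addSn addnC expnD mulnA divnMDl ?expn_gt0 // oddD.
by rewrite oddM oddX /= andbF addSn -addnS subnK //; exact: IHn.
Qed.

Section Code.
Variable c : nat.
Implicit Types S T : {set 'I_c}.

Definition mem_nat S (i : nat) := [exists u in S, val u == i].

Lemma mem_natE S (v : 'I_c) : mem_nat S v = (v \in S).
Proof.
apply/exists_inP/idP => [[u uS /eqP/val_inj <-]//|vS].
by exists v.
Qed.

Definition code S := num (mem_nat S) c.

Lemma code_lt S : code S < 2 ^ c.
Proof. exact: num_lt. Qed.

Lemma bit_code S (v : 'I_c) : bit (code S) v = (v \in S).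
Proof. by rewrite bit_num // mem_natE. Qed.

Lemma code_inj : injective code.
Proof. by move=> S T E; apply/finset.setP => v; rewrite -!bit_code E. Qed.

Lemma code0 : code finset.set0 = 0.
Proof.
rewrite /code /num big1 // => i _.
suff -> : mem_nat finset.set0 i = false by [].
by apply/negbTE/negP => /exists_inP[u]; rewrite inE.
Qed.

End Code.

(* A digital search tree: node [j] holds a key in cell [3 j] and its children
   for the bits 0 and 1 in the next two cells, a child 0 (the root) being
   absent; bit [t] of a key selects the child at depth [t]. *)
Fixpoint walk (g : nat -> nat) x t : option nat :=
  if t is t'.+1 then
    if walk g x t' is Some j then
      let k := g (3 * j + 1 + bit x t') in if k == 0 then None else Some k
    else None
  else Some 0.

(** The last clause gives each node a single depth and makes it determine the bits read on the way
    to it. Paths with different prefixes thus never merge, which confines the effect of changing one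
    child cell. *)
Definition tree g (ks : seq nat) := [/\ forall i, i < size ks -> g (3 * i) = nth 0 ks i,
  forall a, 3 * size ks <= a -> g a = 0,
  forall i, i < size ks -> exists t, walk g (nth 0 ks i) t = Some i &
  exists depth : nat -> nat, forall x t j, walk g x t = Some j ->
    [/\ j < size ks, depth j = t & nth 0 ks j = x %[mod 2 ^ t]]].

Lemma tree0 g : (forall a, g a = 0) -> tree g [:: 0].
Proof.
move=> g0; have w0 x t j : walk g x t = Some j -> j = 0 /\ t = 0.
  by case: t => [[<-]//|t] /=; case: (walk g x t) => // i; rewrite g0.
split=> //.
- by case=> // _; rewrite g0.
- by case=> // _; exists 0.
by exists id => x t j /w0[-> ->]; split=> //=; rewrite !modn1.
Qed.

Lemma walk_none g x t j : walk g x t = Some j -> g (3 * j + 1 + bit x t) = 0 ->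
  forall s, t < s -> walk g x s = None.
Proof.
move=> wt g0; elim=> // s IHs; rewrite ltnS leq_eqVlt => /predU1P[<-|/IHs/= ->//].
by rewrite /= wt g0.
Qed.

(** A stored key lies on its own search path, and this path ends at depth [t]. *)
Lemma tree_absent g ks x t j : tree g ks -> walk g x t = Some j ->
  g (3 * j + 1 + bit x t) = 0 ->
  (forall s i, s <= t -> walk g x s = Some i -> nth 0 ks i != x) -> x \notin ks.
Proof.
move=> [gk _ hw _] wt g0 nx; apply/negP => xks.
have [|s ws] := hw (index x ks); first by rewrite index_mem.
rewrite nth_index // in ws; have [st|ts] := leqP s t.
  by have := nx _ _ st ws; rewrite nth_index // eqxx.
by rewrite (walk_none wt g0 ts) in ws.
Qed.

(** After [c] steps the key of the node agrees with [x] modulo [2 ^ c], which is equality for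
    [c]-bit numbers. This is the bound on the length of a search. *)
Lemma tree_deep g ks x c t j : tree g ks -> (forall i, nth 0 ks i < 2 ^ c) -> x < 2 ^ c ->
  walk g x t = Some j -> c <= t -> nth 0 ks j = x.
Proof.
move=> [_ _ _ [depth hd]] kc xc /hd[_ _]+ ct.
have ct2 : 2 ^ c <= 2 ^ t by rewrite leq_exp2l.
by rewrite !modn_small // (leq_trans _ ct2).
Qed.

Lemma child_neq_key i k (b : bool) : 3 * i + 1 + b != 3 * k.
Proof. by apply/eqP; case: b; lia. Qed.

Lemma child_inj i k (b b' : bool) : 3 * i + 1 + b = 3 * k + 1 + b' -> i = k /\ b = b'.
Proof. by case: b; case: b'; split=> //; lia. Qed.

Section TreeInsert.
Variables (g g' : nat -> nat) (ks : seq nat) (x t j : nat).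
Let N := size ks.
Hypotheses (gT : tree g ks) (wt : walk g x t = Some j) (g0 : g (3 * j + 1 + bit x t) = 0).
Hypotheses (g'N : g' (3 * N) = x) (g'j : g' (3 * j + 1 + bit x t) = N).
Hypothesis g'E : forall a, a != 3 * N -> a != 3 * j + 1 + bit x t -> g' a = g a.

Let jN : j < N.
Proof. by case: gT => _ _ _ [depth hd]; have [] := hd _ _ _ wt. Qed.

Lemma insert_up y s i : walk g y s = Some i -> walk g' y s = Some i.
Proof.
elim: s i => //= s IHs i; case ws: (walk g y s) => [k|//]; rewrite (IHs _ ws).
case: eqP => // /eqP gk0 [<-].
rewrite g'E ?child_neq_key ?(negPf gk0) //.
by apply: contraNneq gk0 => ->; rewrite g0.
Qed.

Lemma insert_new : walk g' x t.+1 = Some N.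
Proof. by rewrite /= (insert_up wt) g'j; case: eqP => // N0; move: jN; rewrite N0. Qed.

(** The one child cell that changes belongs to node [j]: a path through it is at depth [t] and has
    read the bits of [x]. The children of the new node are absent, so such a path goes no
    further. *)
Lemma insert_down y s i : walk g' y s = Some i ->
  walk g y s = Some i \/ [/\ i = N, s = t.+1 & x = y %[mod 2 ^ s]].
Proof.
have [gk tl hw [depth hd]] := gT; have [_ dj jx] := hd _ _ _ wt.
elim: s i => [|s IHs] i; first by left.
rewrite [walk _ _ s.+1]/=; case ws: (walk g' y s) => [k|//].
have [wk|[-> _ _]] := IHs _ ws; last first.
  rewrite g'E ?child_neq_key //.
    by rewrite tl // -/N -addnA leq_addr.
  by apply/eqP => /child_inj[E _]; move: jN; rewrite E ltnn.
have [kN dk kx] := hd _ _ _ wk.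
have [E|nE] := eqVneq (3 * k + 1 + bit y s) (3 * j + 1 + bit x t).
  rewrite E g'j; case: eqP => // _ [<-]; have [Ekj Eb] := child_inj E.
  have Est : s = t by rewrite -dk -dj Ekj.
  rewrite Est in kx Eb *; rewrite Ekj in kx.
  by right; split=> //; rewrite !modn_exp2S Eb -jx -kx.
by rewrite g'E ?child_neq_key //; case: ifP => // gk0 [<-]; left; rewrite /= wk gk0.
Qed.

Lemma tree_insert : tree g' (rcons ks x).
Proof.
have [gk tl hw [depth hd]] := gT; have [_ dj jx] := hd _ _ _ wt.
split.
- move=> i; rewrite size_rcons ltnS leq_eqVlt nth_rcons => /predU1P[->|iN].
    by rewrite ltnn eqxx.
  rewrite iN -gk // g'E //; first by rewrite eqn_mul2l /= ltn_eqF.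
  by rewrite eq_sym child_neq_key.
- move=> a; rewrite size_rcons mulnS => aN; rewrite g'E.
  + by apply: tl; apply: leq_trans aN; exact: leq_addl.
  + by apply/eqP; move: aN; rewrite -/N; lia.
  + by apply/eqP; move: aN jN; rewrite -/N; case: (bit x t); lia.
- move=> i; rewrite size_rcons ltnS leq_eqVlt nth_rcons => /predU1P[->|iN].
    by rewrite ltnn eqxx; exists t.+1; exact: insert_new.
  by rewrite iN; have [s ws] := hw _ iN; exists s; exact: insert_up.
exists (fun i => if i == N then t.+1 else depth i) => y s i /insert_down[/hd[iN di yi]|[-> -> E]].
  by rewrite size_rcons ltn_eqF // ltnW // nth_rcons iN.
by rewrite size_rcons ltnSn eqxx nth_rcons ltnn eqxx.
Qed.

End TreeInsert.

(** * The program *)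

Local Notation Mem := Defs.Mem.
Local Notation Sub := Defs.Sub.
Local Notation rR := 0.
Local Notation rC := 1.
Local Notation rSR := 2.
Local Notation rSC := 3.
Local Notation rKB := 4.
Local Notation rTB := 5.
Local Notation rDir := 6.
Local Notation rCnt := 7.
Local Notation rQ := 8.
Local Notation rH := 9.
Local Notation rF := 10.
Local Notation rV := 11.
Local Notation rW := 12.
Local Notation rP := 13.
Local Notation rOk := 14.
Local Notation rKey := 15.
Local Notation rJ := 16.
Local Notation rX := 17.

(* Behind the input, memory holds a [c] x [c] bit matrix at [rKB], whose entry
   (v, w) tells whether [w] lies in the closure of [H] and [v] for the face [H]
   being explored, and the search tree at [rTB]: its node [j] is the [j]-th face
   found and has the elements of that face, packed in binary, as its key. *)
Definition odd_expr e := Op Sub e (Op Mul (Cst 2) (Op Div e (Cst 2))).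
Definition entry_expr f v := Mem (Op Add (Cst 2) (Op Add (Op Mul (Reg f) (Reg rSR)) (Op Mul (Reg v) (Reg rSC)))).
Definition pair_addr v w := Op Add (Reg rKB) (Op Add (Op Mul (Reg v) (Reg rC)) (Reg w)).
Definition node_addr j := Op Add (Reg rTB) (Op Mul (Cst 3) (Reg j)).
Definition skip := Assign rOk (Reg rOk).

(** Halving [rX] in step with [rW] brings each bit of [H] to the lowest place at constant cost; the
    answer accumulates as a product of 0/1 values. *)
Definition subset_prog :=
  Seq (Assign rOk (Cst 1)) (Seq (Assign rX (Reg rH))
  (for_loop rW (Reg rC)
    (Seq (Assign rOk (Op Mul (Reg rOk) (Op Leq (odd_expr (Reg rX)) (entry_expr rF rW))))
         (Assign rX (Op Div (Reg rX) (Cst 2)))))).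

Definition init_prog :=
  for_loop rW (Op Mul (Reg rC) (Reg rC)) (Store (Op Add (Reg rKB) (Reg rW)) (Cst 1)).

Definition pair_row_prog :=
  for_loop rW (Reg rC)
    (Store (pair_addr rV rW) (Op Mul (Mem (pair_addr rV rW)) (entry_expr rF rW))).

(** Passing over the [v] outside row [f] makes a row cost [c] plus [c] for each of its ones; this is
    how [alpha] enters the running time in place of [r * c]. *)
Definition pair_prog :=
  for_loop rV (Reg rC) (If (entry_expr rF rV) pair_row_prog skip).

Definition rows_prog :=
  for_loop rF (Reg rR) (Seq subset_prog (If (Reg rOk) pair_prog skip)).

(** The body of [selects] in 0/1 arithmetic: [Leq] is implication, [Mul] conjunction, and the
    conditional is the sum of two mutually exclusive products. *)
Definition select_expr :=
  Op Leq (Mem (pair_addr rV rW))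
    (Op Add (Op Mul (odd_expr (Reg rX)) (Op Sub (Cst 1) (Op Eqn (Reg rW) (Reg rV))))
            (Op Mul (Op Sub (Cst 1) (odd_expr (Reg rX)))
                    (Op Mul (Op Leq (Reg rV) (Reg rW)) (Mem (pair_addr rW rV))))).

(** The test and the packing share one pass: [rP] runs through the powers of 2 and [rKey] collects
    the closure as a search key. *)
Definition select_prog :=
  Seq (Assign rOk (Cst 1)) (Seq (Assign rKey (Cst 0)) (Seq (Assign rX (Reg rH))
  (Seq (Assign rP (Cst 1))
  (for_loop rW (Reg rC)
    (Seq (Assign rOk (Op Mul (Reg rOk) select_expr))
    (Seq (Assign rKey (Op Add (Reg rKey) (Op Mul (Mem (pair_addr rV rW)) (Reg rP))))
    (Seq (Assign rP (Op Mul (Reg rP) (Cst 2)))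
         (Assign rX (Op Div (Reg rX) (Cst 2)))))))))).

Definition insert_prog :=
  Seq (Store (Reg rP) (Reg rCnt))
  (Seq (Store (node_addr rCnt) (Reg rKey))
       (Assign rCnt (Op Add (Reg rCnt) (Cst 1)))).

(** The search inserts a missing key on its way: once the new node is linked in place of the absent
    child, the ordinary descent moves onto it and stops because its key matches. Either way [rJ]
    ends as the number of the face. *)
Definition find_prog :=
  Seq (Assign rJ (Cst 0)) (Seq (Assign rX (Reg rKey))
  (While (Op Sub (Cst 1) (Op Eqn (Mem (node_addr rJ)) (Reg rKey)))
    (Seq (Assign rP (Op Add (Op Add (node_addr rJ) (Cst 1)) (odd_expr (Reg rX))))
    (Seq (If (Mem (Reg rP)) skip insert_prog)
    (Seq (Assign rJ (Mem (Reg rP)))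
         (Assign rX (Op Div (Reg rX) (Cst 2)))))))).

Definition emit_prog :=
  If (Reg rDir) (Seq (Write (Reg rJ)) (Write (Reg rQ)))
                (Seq (Write (Reg rQ)) (Write (Reg rJ))).

Definition visit_prog :=
  for_loop rV (Reg rC) (Seq select_prog (If (Reg rOk) (Seq find_prog emit_prog) skip)).

Definition face_prog :=
  Seq (Assign rH (Mem (node_addr rQ)))
  (Seq init_prog (Seq rows_prog (Seq visit_prog
       (Assign rQ (Op Add (Reg rQ) (Cst 1)))))).

Definition explore_prog :=
  Seq (Assign rCnt (Cst 1)) (Seq (Assign rQ (Cst 0))
  (Seq (While (Op Leq (Op Add (Reg rQ) (Cst 1)) (Reg rCnt)) face_prog)
       (Write (Reg rCnt)))).

(* The columns are taken to be the smaller of the two sides; [rSR] and [rSC] are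
   the address increments between rows and between columns, so that the matrix
   need not be transposed. *)
Definition setup_prog :=
  Seq (Assign rX (Cst 0))
  (Seq (If (Op Leq (Mem (Cst 1)) (Mem (Cst 0)))
    (Seq (Assign rR (Mem (Cst 0))) (Seq (Assign rC (Mem (Cst 1)))
    (Seq (Assign rSR (Mem (Cst 1))) (Seq (Assign rSC (Cst 1)) (Assign rDir (Cst 0))))))
    (Seq (Assign rR (Mem (Cst 1))) (Seq (Assign rC (Mem (Cst 0)))
    (Seq (Assign rSR (Cst 1)) (Seq (Assign rSC (Mem (Cst 1))) (Assign rDir (Cst 1)))))))
  (Seq (Assign rKB (Op Add (Cst 2) (Op Mul (Reg rR) (Reg rC))))
       (Assign rTB (Op Add (Reg rKB) (Op Mul (Reg rC) (Reg rC)))))).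

Definition hasse_prog := Seq setup_prog explore_prog.

Lemma subn_mul2_div2 x : x - 2 * (x %/ 2) = odd x.
Proof. rewrite divn2 mul2n -{1}(odd_double_half x) addnK //. Qed.

Lemma bitE x t : x %/ 2 ^ t - 2 * (x %/ 2 ^ t %/ 2) = bit x t.
Proof. exact: subn_mul2_div2. Qed.

Lemma divn_exp2S x t : x %/ 2 ^ t %/ 2 = x %/ 2 ^ t.+1.
Proof. by rewrite -divnMA expnSr. Qed.

Lemma mulb_leq (b b1 b2 : bool) : b * (b1 <= b2) = b && (b1 ==> b2).
Proof. by case: b; case: b1; case: b2. Qed.

(** * Simulation of the exploration by the machine *)

Section Program.
Variables (r c : nat) (B : 'M[bool]_(r, c)) (sr sc phi W : nat) (dir : bool).
Definition pair_base := 2 + r * c.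
Definition tree_base := pair_base + c * c.
Definition mem_size := tree_base + 3 * phi.
(** Only the two dimensions of the matrix get [W] bits. Matrix entries and closure bits take one
    bit, and a tree cell holds a key or a node number, both below [2 ^ c]. *)
Definition cell_bound a := if a < 2 then W else if a < tree_base then 1 else c.

Hypothesis addr : forall (f : 'I_r) (v : 'I_c), f * sr + v * sc < r * c.
Hypothesis cW : c < W.
Hypothesis sizeW : mem_size + r + c + 4 <= 2 ^ W.
Hypothesis phiE : phi = #|[pred S | closed_set B S]|.

Local Notation kb := pair_base.
Local Notation tb := tree_base.
Local Notation St cnt q h f v w p ok key j x mem out :=
  (State [:: r; c; sr; sc; kb; tb; nat_of_bool dir; cnt : nat; q : nat; h : nat; f : nat; v : nat; w : nat;
    p : nat; ok : nat; key : nat; j : nat; x : nat] mem out).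
Local Notation fits := (fits W mem_size cell_bound).
Local Notation runs := (runs W mem_size cell_bound).
Local Notation cell mem a := (nth 0 mem a).

Definition entries mem := forall (f : 'I_r) (v : 'I_c), cell mem (2 + (f * sr + v * sc)) = B f v.

Definition pairs mem (K : 'I_c -> 'I_c -> bool) :=
  forall v w : 'I_c, cell mem (kb + (v * c + w)) = K v w.

(** Frame condition for the passes that compute closures: input and tree survive them. Its
    counterpart for the tree search is [same_below]. *)
Definition same_off mem mem' := forall a, (a < kb) || (tb <= a) -> cell mem' a = cell mem a.

Lemma same_off_trans mem1 mem2 mem3 :
  same_off mem1 mem2 -> same_off mem2 mem3 -> same_off mem1 mem3.
Proof. by move=> h1 h2 a ha; rewrite h2 // h1. Qed.

Lemma entries_same_off mem mem' : same_off mem mem' -> entries mem -> entries mem'.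
Proof. by move=> h e f v; rewrite h ?e // ltn_add2l addr. Qed.

Lemma pair_addr_lt (v w : 'I_c) : v * c + w < c * c.
Proof.
have vc := ltn_ord v; have wc := ltn_ord w.
apply: (@leq_trans (v * c + c)); first by rewrite ltn_add2l.
by rewrite addnC -mulSn leq_mul2r vc orbT.
Qed.

Lemma pair_addr_inj (v w v' w' : 'I_c) : (v * c + w == v' * c + w') = (v == v') && (w == w').
Proof.
apply/eqP/andP => [E|[/eqP-> /eqP->]//].
have c0 : 0 < c by exact: leq_ltn_trans (leq0n v) (ltn_ord v).
have Ev : v = v'.
  apply: val_inj => /=; move: (congr1 (fun n => n %/ c) E).
  by rewrite !divnMDl // !divn_small // !addn0.
rewrite Ev eqxx; split=> //; move: E; rewrite Ev => /addnI/val_inj ->.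
by [].
Qed.

Lemma c_ltW : 2 ^ c < 2 ^ W. Proof. by rewrite ltn_exp2l. Qed.

Lemma small_ltW n : n <= mem_size + r + c + 3 -> n < 2 ^ W.
Proof. by move=> h; apply: leq_trans sizeW; lia. Qed.

Lemma cell_bound_pair a : kb <= a -> a < tb -> cell_bound a = 1.
Proof. by move=> ka atb; rewrite /cell_bound atb ltnNge (leq_trans _ ka) ?leq_addr. Qed.

Lemma cell_bound_tree a : tb <= a -> cell_bound a = c.
Proof.
clear addr cW sizeW; move=> ta; have t2 : 2 <= tb by rewrite /tree_base /pair_base; lia.
by rewrite /cell_bound ltnNge (leq_trans t2 ta) ltnNge ta.
Qed.

Lemma runs_subset cnt q v w p ok key j x mem out (f : 'I_r) (H : {set 'I_c}) :
  entries mem -> fits (St cnt q (code H) f v w p ok key j x mem out) ->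
  runs subset_prog (St cnt q (code H) f v w p ok key j x mem out) (50 * c + 20)
    (fun s' => s' = St cnt q (code H) f v c p (in_row B f H) key j (code H %/ 2 ^ c) mem out).
Proof.
move=> em fs.
pose I t s := s = St cnt q (code H) f v t p
  [forall u : 'I_c, (u < t) ==> (u \in H) ==> B f u] key j (code H %/ 2 ^ t) mem out.
eapply runs_leT.
  eapply runs_assign_seq => //=; first by rewrite (leq_ltn_trans _ c_ltW) ?expn_gt0.
  move=> {}fs; eapply runs_assign_seq => //=.
    exact: ltn_trans (code_lt _) c_ltW.
  move=> {}fs; eapply runs_le; [apply: (runs_for (I := I) (n := c) (T := fun=> 30))| |] => //=.
  - by apply: small_ltW; lia.
  - rewrite /I divn1; congr (State [:: _; _; _; _; _; _; _; _; _; _; _; _; _; _; _; _; _; _] _ _).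
    by rewrite (_ : [forall u, _] = true) //; apply/forallP.
  - by move=> k s -> /=.
  - move=> t s fst E; rewrite E /= in fst *.
    eapply runs_leT.
      eapply runs_assign_seq => //=.
        rewrite bitE em mulb_leq; apply: small_ltW; case: (_ && _); lia.
      move=> fs1; apply: runs_assign => //=.
        by apply: leq_ltn_trans (leq_div _ _) _; apply: leq_ltn_trans (leq_div _ _) _; exact: ltn_trans (code_lt _) c_ltW.
      split=> //; rewrite /I bitE em mulb_leq divn_exp2S bit_code.
      congr (State [:: _; _; _; _; _; _; _; _; _; _; _; _; _; _; nat_of_bool _; _; _; _] _ _).
      apply/andP/forallP => [[/forallP h ht] u|h].
        apply/implyP; rewrite ltnS leq_eqVlt => /predU1P[/val_inj->//|ut].
        by have := h u; rewrite ut.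
      split; last by have := h t; rewrite ltnSn.
      by apply/forallP => u; apply/implyP => ut; have := h u; rewrite ltnS ltnW.
    by [].
  move=> s' fs' ->; congr (State [:: _; _; _; _; _; _; _; _; _; _; _; _; _; _; nat_of_bool _; _; _; _] _ _).
  by apply: eq_forallb => u; rewrite ltn_ord.
rewrite sum_nat_const card_ord /=; lia.
Qed.

Lemma runs_init cnt q h f v w p ok key j x mem out :
  fits (St cnt q h f v w p ok key j x mem out) ->
  runs init_prog (St cnt q h f v w p ok key j x mem out) (30 * (c * c) + 20)
    (fun s' => exists mem', [/\ s' = St cnt q h f v (c * c) p ok key j x mem' out,
      same_off mem mem' & pairs mem' (fun _ _ => true)]).
Proof.
move=> fs.
pose I t s := exists mem', [/\ s = St cnt q h f v t p ok key j x mem' out,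
  same_off mem mem' & forall a, a < t -> cell mem' (kb + a) = 1].
eapply runs_leT.
  eapply runs_le; [apply: (runs_for (I := I) (n := c * c) (T := fun=> 10))| |] => //=.
  - by apply: small_ltW; rewrite /mem_size /tree_base; lia.
  - by exists mem; split.
  - by move=> k s [mem' [-> _ _]].
  - move=> t s fst [mem' [E so h1]]; rewrite E /= in fst *.
    have kt : kb + t < tb by rewrite ltn_add2l.
    eapply runs_leT.
      apply: runs_store => //=; first by apply: (leq_trans kt); exact: leq_addr.
        by rewrite cell_bound_pair // leq_addr.
      split=> //; exists (set_nth 0 mem' (kb + t) 1); split=> //.
        move=> a ha; rewrite nth_set_nth /=; case: eqP => [E1|_]; last exact: so.
        by move: ha; rewrite E1 ltnNge leq_addr leqNgt kt.
      move=> a; rewrite ltnS leq_eqVlt nth_set_nth /= eqn_add2l; case: eqP => //= _ at1.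
      exact: h1.
    by [].
  move=> s' fs' [mem' [-> so h1]]; exists mem'; split=> // a b.
  by rewrite h1 // pair_addr_lt.
rewrite sum_nat_const card_ord /=; lia.
Qed.

Lemma runs_pair_row cnt q h w p ok key j x mem out (f : 'I_r) (v : 'I_c) K :
  entries mem -> pairs mem K -> fits (St cnt q h f v w p ok key j x mem out) ->
  runs pair_row_prog (St cnt q h f v w p ok key j x mem out) (50 * c + 20)
    (fun s' => exists mem', [/\ s' = St cnt q h f v c p ok key j x mem' out, same_off mem mem' &
      pairs mem' (fun v' w' => K v' w' && ((v' == v) ==> B f w'))]).
Proof.
move=> em km fs.
pose I t s := exists mem', [/\ s = St cnt q h f v t p ok key j x mem' out, same_off mem mem' &
  pairs mem' (fun v' w' => K v' w' && ((v' == v) && (w' < t) ==> B f w'))].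
eapply runs_leT.
  eapply runs_le; [apply: (runs_for (I := I) (n := c) (T := fun=> 30))| |] => //=.
  - by apply: small_ltW; lia.
  - by exists mem; split=> // v' w'; rewrite andbF andbT.
  - by move=> k s [mem' [-> _ _]].
  - move=> t s fst [mem' [E so pm]]; rewrite E /= in fst *.
    have kt : kb + (v * c + t) < tb by rewrite ltn_add2l pair_addr_lt.
    have em' := entries_same_off so em.
    eapply runs_leT.
      apply: runs_store => //=; first by apply: (leq_trans kt); exact: leq_addr.
        by rewrite em' pm mulnb cell_bound_pair ?leq_addr //; case: (_ && _).
      split=> //; eexists; split; first by [].
        move=> a ha; rewrite nth_set_nth /=; case: eqP => [E1|_]; last exact: so.
        by move: ha; rewrite E1 ltnNge leq_addr leqNgt kt.
      move=> v' w'; rewrite nth_set_nth /= eqn_add2l pair_addr_inj em' !pm mulnb.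
      have [->|nv] := eqVneq v' v; last by [].
      have [->|nw] := eqVneq w' t; first by rewrite /= eqxx ltnn ltnSn /= andbT.
      by rewrite /= ltnS [w' <= t]leq_eqVlt (inj_eq val_inj) (negPf nw).
    by [].
  move=> s' fs' [mem' [-> so h1]]; exists mem'; split=> // a b.
  by rewrite h1 ltn_ord andbT.
rewrite sum_nat_const card_ord /=; lia.
Qed.

Definition row_weight (f : 'I_r) := \sum_(v < c) B f v.

Lemma pairs_ext mem K K' : pairs mem K -> (forall v w, K v w = K' v w) -> pairs mem K'.
Proof. by move=> h E v w; rewrite h E. Qed.

Lemma runs_skip s Q : fits s -> nth 0 (registers s) rOk < 2 ^ W -> Q (set_reg s rOk (nth 0 (registers s) rOk)) ->
  runs skip s 2 Q.
Proof. by move=> fs h Qs; apply: runs_assign. Qed.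

Lemma runs_pair cnt q h v w p ok key j x mem out (f : 'I_r) K :
  entries mem -> pairs mem K -> fits (St cnt q h f v w p ok key j x mem out) ->
  runs pair_prog (St cnt q h f v w p ok key j x mem out)
    (33 * c + row_weight f * (50 * c + 20) + 12)
    (fun s' => exists w' mem', [/\ s' = St cnt q h f c w' p ok key j x mem' out, same_off mem mem' &
      pairs mem' (fun v' w' => K v' w' && (B f v' ==> B f w'))]).
Proof.
move=> em km fs.
pose I t s := exists w' mem', [/\ s = St cnt q h f t w' p ok key j x mem' out, same_off mem mem' &
  pairs mem' (fun v' w' => K v' w' && ((v' < t) && B f v' ==> B f w'))].
(* The time of an iteration depends on the entry, so that the sum over [v] yields the weight of the
   row. *)
pose T (v : 'I_c) := 20 + (if B f v then 50 * c + 20 else 2).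
eapply runs_leT.
  eapply runs_le; [apply: (runs_for (I := I) (n := c) (T := T))| |] => //=.
  - by apply: small_ltW; lia.
  - by exists w, mem; split=> // v' w'; rewrite andbT.
  - by move=> k s [w' [mem' [-> _ _]]].
  - move=> t s fst [w' [mem' [E so pm]]]; rewrite E in fst *.
    have em' := entries_same_off so em.
    rewrite /T; case Bt: (B f t).
      eapply runs_leT.
        apply: (runs_if (T := 50 * c + 20)) => /=; rewrite em' Bt // => _.
        eapply runs_le; [apply: runs_pair_row em' pm fst|exact: leqnn|].
        move=> s' fs' [mem'' [-> so' pm']]; split=> //; exists c, mem''; split=> //.
          exact: same_off_trans so so'.
        apply: pairs_ext pm' _ => v' u'; rewrite -andbA; congr (_ && _).
        have [->|nv] := eqVneq v' t; first by rewrite ltnn ltnSn Bt.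
        by rewrite ltnS [v' <= t]leq_eqVlt (inj_eq val_inj) (negPf nv) andbT.
      by rewrite /=; lia.
    eapply runs_leT.
      apply: (runs_if (T := 2)) => /=; rewrite em' Bt // => _.
      apply: runs_skip => //; first by have [_ /(_ rOk)] := fst.
      split=> //; exists w', mem'; split=> //.
      apply: pairs_ext pm _ => v' u'; congr (_ && _).
      have [->|nv] := eqVneq v' t; first by rewrite Bt !andbF.
      by rewrite ltnS [v' <= t]leq_eqVlt (inj_eq val_inj) (negPf nv).
    by rewrite /=; lia.
  move=> s' fs' [w' [mem' [-> so pm]]]; exists w', mem'; split=> //.
  by apply: pairs_ext pm _ => v' u'; rewrite ltn_ord.
apply: (@leq_trans (\sum_(v < c) (33 + B f v * (50 * c + 20)) + 12)).
  rewrite -addnS; apply: leq_add; last by [].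
  by apply: leq_sum => v' _; rewrite /T; case: (B f v'); rewrite /=; lia.
by rewrite big_split /= sum_nat_const card_ord -big_distrl /= mulnC.
Qed.

Lemma runs_rows cnt q f v w p ok key j x mem out (H : {set 'I_c}) :
  entries mem -> pairs mem (fun _ _ => true) -> fits (St cnt q (code H) f v w p ok key j x mem out) ->
  runs rows_prog (St cnt q (code H) f v w p ok key j x mem out)
    (r * (83 * c + 50) + (\sum_(f < r) row_weight f) * (50 * c + 20) + 12)
    (fun s' => exists v w ok x mem', [/\ s' = St cnt q (code H) r v w p ok key j x mem' out,
      same_off mem mem' & pairs mem' (fun v w => w \in cl1 B H v)]).
Proof.
move=> em km fs.
pose I t s := exists v w ok x mem', [/\ s = St cnt q (code H) t v w p ok key j x mem' out,
  same_off mem mem' &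
  pairs mem' (fun v w => [forall f : 'I_r, (f < t) ==> in_row B f H ==> B f v ==> B f w])].
pose T (f : 'I_r) := 50 * c + 20 + (2 + (33 * c + row_weight f * (50 * c + 20) + 14)).
eapply runs_leT.
  eapply runs_le; [apply: (runs_for (I := I) (n := r) (T := T))| |] => //=.
  - by apply: small_ltW; lia.
  - exists v, w, ok, x, mem; split=> //; apply: pairs_ext km _ => v' w'.
    by apply/esym/forallP.
  - by move=> k s [? [? [? [? [? [-> _ _]]]]]].
  - move=> t s fst [v1 [w1 [ok1 [x1 [mem1 [E so pm]]]]]]; rewrite E in fst *.
    have em1 := entries_same_off so em.
    have forallS (A : 'I_r -> bool) : [forall g : 'I_r, (g < t.+1) ==> A g] =
        [forall g : 'I_r, (g < t) ==> A g] && A t.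
      apply/forallP/andP => [h|[/forallP h At] g].
        split; last by have := h t; rewrite ltnSn.
        by apply/forallP => g; apply/implyP => gt; have := h g; rewrite ltnS ltnW.
      by apply/implyP; rewrite ltnS leq_eqVlt => /predU1P[/val_inj->//|gt]; have := h g; rewrite gt.
    apply: runs_seq (runs_subset em1 fst) _ => s1 fs1 E1; rewrite E1 in fs1 *.
    eapply runs_leT.
      apply: (runs_if (T := 33 * c + row_weight t * (50 * c + 20) + 14)) => /=.
        rewrite eqb0 negbK => inr.
        eapply runs_le; [apply: runs_pair em1 pm fs1|by lia|].
        move=> s' fs' [w' [mem' [-> so' pm']]]; split=> //; do 5 eexists; split; first by [].
          exact: same_off_trans so so'.
        by apply: pairs_ext pm' _ => v' u'; rewrite forallS inr.
      move: fs1; case inr: (in_row B t H) => // fs1 _.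
      eapply runs_leT.
        apply: runs_skip => //; first by rewrite /= expn_gt0.
        split=> //; do 5 eexists; split; [by []|exact: so|].
        by apply: pairs_ext pm _ => v' u'; rewrite forallS inr andbT.
      by lia.
    by [].
  move=> s' fs' [v1 [w1 [ok1 [x1 [mem1 [-> so pm]]]]]]; exists v1, w1, ok1, x1, mem1; split=> //.
  apply: pairs_ext pm _ => v' u'; apply/forallP/cl1P => h g.
    by move=> h1 h2; have := h g; rewrite ltn_ord h1 h2.
  by rewrite ltn_ord /=; apply/implyP => h1; apply/implyP => h2; exact: h.
rewrite -addnS; apply: leq_add; last by [].
rewrite big_distrl /= -[X in X * (83 * c + 50)]card_ord -sum_nat_const -big_split /=.
by apply: leq_sum => g _; rewrite /T; lia.
Qed.

Lemma runs_select cnt q f (v : 'I_c) w p ok key j x mem out (H : {set 'I_c}) :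
  pairs mem (fun v w => w \in cl1 B H v) -> fits (St cnt q (code H) f v w p ok key j x mem out) ->
  runs select_prog (St cnt q (code H) f v w p ok key j x mem out) (100 * c + 30)
    (fun s' => s' = St cnt q (code H) f v c (2 ^ c) (selects B H v) (code (cl1 B H v)) j
      (code H %/ 2 ^ c) mem out).
Proof.
move=> pm fs.
pose I t s := s = St cnt q (code H) f v t (2 ^ t)
  [forall u : 'I_c, (u < t) ==> (u \in cl1 B H v) ==>
    if u \in H then u != v else (v <= u) && (v \in cl1 B H u)]
  (num (mem_nat (cl1 B H v)) t) j (code H %/ 2 ^ t) mem out.
have HW : code H < 2 ^ W by exact: ltn_trans (code_lt _) c_ltW.
have W1 : 1 < 2 ^ W by apply: leq_ltn_trans c_ltW; rewrite expn_gt0.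
eapply runs_leT.
  eapply runs_assign_seq => //= {}fs.
  eapply runs_assign_seq => //=; first by rewrite expn_gt0.
  move=> {}fs; eapply runs_assign_seq => //= {}fs; eapply runs_assign_seq => //= {}fs.
  eapply runs_le; [apply: (runs_for (I := I) (n := c) (T := fun=> 80))| |] => //=.
  - by apply: small_ltW; lia.
  - rewrite /I divn1 /num big_ord0.
    congr (State [:: _; _; _; _; _; _; _; _; _; _; _; _; _; _; _; _; _; _] _ _).
    by rewrite (_ : [forall u, _] = true) //; apply/forallP.
  - by move=> k s -> /=.
  - move=> t s fst E; rewrite E in fst *.
    have selE (b bH bv le : bool) (b1 b2 : bool) : b * (b1 <= bH * (1 - bv) + (1 - bH) * (le * b2)) =
        b && (b1 ==> if bH then ~~ bv else le && b2).
      by case: b; case: b1; case: bH; case: bv; case: le; case: b2.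
    eapply runs_leT.
      eapply runs_assign_seq => //=.
        by rewrite bitE !pm selE; apply: leq_ltn_trans (leq_b1 _) W1.
      move=> fs1; eapply runs_assign_seq => //=.
        rewrite pm -mem_natE -numS.
        apply: leq_trans (num_lt _ _) _; apply: leq_trans _ (ltnW c_ltW).
        by rewrite leq_exp2l.
      move=> fs2; eapply runs_assign_seq => //=.
        by rewrite -expnSr; apply: leq_ltn_trans _ c_ltW; rewrite leq_exp2l.
      move=> fs3; apply: runs_assign => //=.
        by apply: leq_ltn_trans (leq_div _ _) _; apply: leq_ltn_trans (leq_div _ _) _.
      split=> //; rewrite /I bitE !pm selE divn_exp2S -mem_natE -numS -expnSr bit_code.
      congr (State [:: _; _; _; _; _; _; _; _; _; _; _; _; _; _; nat_of_bool _; _; _; _] _ _).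
      rewrite mem_natE; apply/andP/forallP => [[/forallP h ht] u|h].
        apply/implyP; rewrite ltnS leq_eqVlt => /predU1P[/val_inj->//|ut].
        by have := h u; rewrite ut.
      split; last by have := h t; rewrite ltnSn.
      by apply/forallP => u; apply/implyP => ut; have := h u; rewrite ltnS ltnW.
    by [].
  move=> s' fs' ->; congr (State [:: _; _; _; _; _; _; _; _; _; _; _; _; _; _; nat_of_bool _; _; _; _] _ _).
  by apply: eq_forallb => u; rewrite ltn_ord.
rewrite sum_nat_const card_ord /=; lia.
Qed.

Definition faces_tree mem (Ss : seq {set 'I_c}) :=
  tree (fun a => cell mem (tb + a)) (map (@code c) Ss).

Definition same_below mem mem' := forall a, a < tb -> cell mem' a = cell mem a.

(** Node numbers are below [phi], so they fit into the [c] bits of a tree cell. *)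
Lemma phi_le : phi <= 2 ^ c.
Proof.
rewrite phiE; apply: leq_trans (max_card _) _.
have -> : #|{: {set 'I_c}}| = #|powerset [set: 'I_c]%SET|.
  by apply: eq_card => S; rewrite !inE finset.subsetT.
by rewrite card_powerset finset.cardsT card_ord.
Qed.

Lemma runs_find q h f v w p ok j x mem out (Ss : seq {set 'I_c}) T
    (Ss' := if T \in Ss then Ss else rcons Ss T) :
  faces_tree mem Ss -> uniq Ss -> size Ss' <= phi ->
  fits (St (size Ss) q h f v w p ok (code T) j x mem out) ->
  runs find_prog (St (size Ss) q h f v w p ok (code T) j x mem out) (120 * c + 40)
    (fun s' => exists p x mem', [/\ s' = St (size Ss') q h f v w p ok (code T) (index T Ss) x mem' out,
      faces_tree mem' Ss' & same_below mem mem']).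
Proof.
move=> tr uS sphi fs.
pose g := (fun a => cell mem (tb + a)); pose ks := map (@code c) Ss.
rewrite /faces_tree -/g -/ks in tr.
have sks : size ks = size Ss by rewrite size_map.
have TW : code T < 2 ^ W by exact: ltn_trans (code_lt _) c_ltW.
have ksc i : nth 0 ks i < 2 ^ c.
  have [iS|iS] := ltnP i (size ks); last by rewrite nth_default // expn_gt0.
  by rewrite (nth_map finset.set0) -?sks // code_lt.
have memT : (code T \in ks) = (T \in Ss) by rewrite mem_map //; exact: code_inj.
(* During the descent, [t] bits have been consumed and the nodes above the current one have other
   keys. The second case arises only after an insertion: the current node is the new one, and the
   guard is about to fail. *)
pose I t s :=
  (exists j p, [/\ s = St (size Ss) q h f v w p ok (code T) j (code T %/ 2 ^ t) mem out,
    walk g (code T) t = Some j &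
    forall s i, s < t -> walk g (code T) s = Some i -> nth 0 ks i != code T]) \/
  T \notin Ss /\ (exists p x mem',
    [/\ s = St (size Ss).+1 q h f v w p ok (code T) (size Ss) x mem' out,
    faces_tree mem' (rcons Ss T) & same_below mem mem']).
have [gk tl hw [depth hd]] := tr.
eapply runs_leT.
  eapply runs_assign_seq => //=; first by rewrite expn_gt0.
  move=> {}fs; eapply runs_assign_seq => //= {}fs.
  eapply runs_le; [apply: (runs_while (n := c) (I := I) (T := fun=> 100) _ fs (leq0n c))|exact: leqnn|].
  - move=> t s fst [[i [p' [E wt nk]]]|[nT [p' [x' [mem' [E tr' sb]]]]]]; rewrite E in fst *; last first.
      have [gk' _ _ _] := tr'; have := gk' (size Ss); rewrite map_rcons size_rcons size_map.
      rewrite nth_rcons size_map ltnn eqxx => /(_ (ltnSn _)) gN.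
      by rewrite /= gN eqxx.
    have [iN di imod] := hd _ _ _ wt.
    have gi : cell mem (tb + 3 * i) = nth 0 ks i by exact: gk.
    rewrite /= gi => guard.
    have nki : nth 0 ks i != code T by apply: contraNneq guard => ->; rewrite eqxx.
    have tc : t < c.
      by rewrite ltnNge; apply: contra nki => ct; apply/eqP; exact: tree_deep tr ksc (code_lt _) wt ct.
    split=> //.
    set A := tb + 3 * i + 1 + bit (code T) t.
    have AE : A = tb + (3 * i + 1 + bit (code T) t) by rewrite /A !addnA.
    have iphi : i < phi.
      by apply: leq_trans sphi; rewrite sks in iN; apply: leq_trans iN _; rewrite /Ss'; case: ifP; rewrite ?size_rcons.
    have AZ : A < mem_size.
      by rewrite AE ltn_add2l; move: iphi; case: (bit _ _); lia.
    have nk' s' k : s' < t.+1 -> walk g (code T) s' = Some k -> nth 0 ks k != code T.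
      rewrite ltnS leq_eqVlt => /predU1P[->|]; last exact: nk.
      by rewrite wt => -[<-].
    have xW : code T %/ 2 ^ t %/ 2 < 2 ^ W.
      by apply: leq_ltn_trans (leq_div _ _) _; apply: leq_ltn_trans (leq_div _ _) _.
    eapply runs_leT.
      eapply runs_assign_seq => //=.
        by rewrite bitE; apply: leq_trans AZ _; apply: leq_trans sizeW; lia.
      rewrite bitE -/A => fs1.
      pose Q1 s' := if cell mem A == 0 then
         s' = St (size Ss).+1 q h f v w A ok (code T) i (code T %/ 2 ^ t)
                (set_nth 0 (set_nth 0 mem A (size Ss)) (tb + 3 * size Ss) (code T)) out
       else s' = St (size Ss) q h f v w A ok (code T) i (code T %/ 2 ^ t) mem out.
      apply: (runs_seq (T1 := 60) (T2 := 10) (Q1 := Q1)).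
        eapply runs_leT.
          apply: (runs_if (T := 50)) => /= [cA|cA].
            eapply runs_leT; first apply: runs_skip => //.
              by have [_ /(_ rOk)] := fs1.
              by rewrite /Q1 (negPf cA).
            by [].
          have nT : T \notin Ss.
            rewrite -memT; apply: (tree_absent tr wt); first by rewrite -[LHS]/(cell mem (tb + _)) -AE.
            by move=> s' k st; exact: nk'.
          have Nphi : size Ss < phi by move: sphi; rewrite /Ss' (negPf nT) size_rcons.
          eapply runs_leT.
            eapply runs_store_seq => //=.
              rewrite cell_bound_tree; last by rewrite AE leq_addr.
              exact: leq_trans Nphi phi_le.
            move=> fs2; eapply runs_store_seq => //=.
              by rewrite ltn_add2l ltn_mul2l.
              by rewrite cell_bound_tree ?leq_addr // code_lt.
            move=> fs3; apply: runs_assign => //=.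
              by apply: small_ltW; rewrite /mem_size; lia.
            by rewrite /Q1 cA eqxx addn1.
          by [].
        by [].
      move=> s1 fs1'; rewrite /Q1; case: eqP => [cA|/eqP cA] E1; rewrite E1 in fs1' *.
        have nT : T \notin Ss.
          rewrite -memT; apply: (tree_absent tr wt); first by rewrite -[LHS]/(cell mem (tb + _)) -AE.
          by move=> s' k st; exact: nk'.
        have ANe : (A == tb + 3 * size Ss) = false.
          by rewrite AE eqn_add2l; apply/negbTE; exact: child_neq_key.
        have Nphi : size Ss < phi by move: sphi; rewrite /Ss' (negPf nT) size_rcons.
        have cellA : cell (set_nth 0 (set_nth 0 mem A (size Ss)) (tb + 3 * size Ss) (code T)) A = size Ss.
          by rewrite nth_set_nth /= ANe nth_set_nth /= eqxx.
        eapply runs_leT.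
          eapply runs_assign_seq => //=; rewrite cellA.
            by apply: small_ltW; rewrite /mem_size; lia.
          move=> fs2; apply: runs_assign => //=.
          right; split=> //; eexists; eexists; eexists; split; first by [].
            rewrite /faces_tree map_rcons; apply: (tree_insert tr wt); rewrite ?size_map.
            - by rewrite -[LHS]/(cell mem (tb + _)) -AE.
            - by rewrite nth_set_nth /= eqxx.
            - by rewrite -AE.
            - move=> a a1 a2; rewrite nth_set_nth /= eqn_add2l (negPf a1).
              by rewrite nth_set_nth /= AE eqn_add2l (negPf a2).
          move=> a atb; rewrite nth_set_nth /= ltn_eqF; last by rewrite (leq_trans atb) ?leq_addr.
          by rewrite nth_set_nth /= ltn_eqF // AE (leq_trans atb) ?leq_addr.
        by [].
      have wS : walk g (code T) t.+1 = Some (cell mem A).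
        by rewrite /= wt /g -AE (negPf cA).
      have [cN _ _] := hd _ _ _ wS.
      eapply runs_leT.
        eapply runs_assign_seq => //=.
          apply: small_ltW; rewrite sks in cN.
          have : size Ss <= phi by apply: leq_trans sphi; rewrite /Ss'; case: ifP; rewrite ?size_rcons.
          by rewrite /mem_size; lia.
        move=> fs2; apply: runs_assign => //=.
        by left; exists (cell mem A), A; split=> //; rewrite divn_exp2S.
      by [].
    by [].
  - by left; exists 0, p; split=> //; rewrite divn1.
  move=> s' fs' [t [_ It guard]]; case: It guard => [[i [p' [-> wt _]]]|[nT [p' [x' [mem' [-> tr' sb]]]]]].
    have [iN _ _] := hd _ _ _ wt.
    have gi : cell mem (tb + 3 * i) = nth 0 ks i by exact: gk.
    rewrite /= gi; case: eqP => // E _.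
    have iS : i < size Ss by rewrite -sks.
    have ET : nth finset.set0 Ss i = T by apply: code_inj; rewrite -E (nth_map finset.set0).
    have TS : T \in Ss by rewrite -ET mem_nth.
    rewrite /Ss' TS; do 3 eexists; split; [|exact: tr|by []].
    by rewrite -ET index_uniq.
  move=> _; rewrite /Ss' (negPf nT); exists p', x', mem'; split=> //.
  by rewrite size_rcons memNindex.
by rewrite big_const_nat iter_addn subn0 /=; lia.
Qed.

Definition arcs_out (arcs : seq (nat * nat)) : seq nat :=
  flatten [seq if dir then [:: a.2; a.1] else [:: a.1; a.2] | a <- arcs].

Lemma arcs_out_rcons arcs i k :
  arcs_out (rcons arcs (i, k)) = arcs_out arcs ++ (if dir then [:: k; i] else [:: i; k]).
Proof. by rewrite /arcs_out map_rcons flatten_rcons. Qed.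

(** A duplicate-free list of closed sets cannot outgrow their number. This bounds the size of the
    tree and the number of faces treated. *)
Lemma explored_size q v st : explored B q v st -> size st.1 <= phi.
Proof.
case: st => Ss arcs /= [[uS _] cS _ _ _]; rewrite phiE cardE.
by apply: uniq_leq_size => // S /cS; rewrite mem_enum.
Qed.

(** The list grows only at its end, so the face being treated keeps its place while its covers are
    appended. *)
Lemma visits_nth q v st : v <= c -> q < size st.1 ->
  q < size (visits B q v st).1 /\
  nth finset.set0 (visits B q v st).1 q = nth finset.set0 st.1 q.
Proof.
move=> + qs; elim: v => [|v IHv] vc; first by rewrite /visits take0.
have [s1 n1] := IHv (ltnW vc); rewrite (visitsS B q (Ordinal vc)) /visit.
case: ifP => //= _; case: ifP => //= _.
by rewrite size_rcons nth_rcons s1 ltnW.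
Qed.

Lemma runs_emit cnt q h f v w p ok key j x mem out Q :
  fits (St cnt q h f v w p ok key j x mem out) ->
  (fits (St cnt q h f v w p ok key j x mem (out ++ if dir then [:: j; q] else [:: q; j])) ->
   Q (St cnt q h f v w p ok key j x mem (out ++ if dir then [:: j; q] else [:: q; j]))) ->
  runs emit_prog (St cnt q h f v w p ok key j x mem out) 10 Q.
Proof.
move=> fs hQ; eapply runs_leT.
  apply: (runs_if (T := 4)) => /=.
    case E: dir hQ fs => // hQ fs _; eapply runs_leT.
      eapply (runs_seq (T1 := 2) (T2 := 2) (Q1 := fun s => s = St cnt q h f v w p ok key j x mem (rcons out j)));
        [apply: runs_write => //|].
        by rewrite /write /= E.
      move=> s1 fs1 E1; rewrite E1 in fs1 *; apply: runs_write => //=.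
      rewrite E in fs1 *; move: hQ; rewrite /write /= -!cats1 -catA; apply.
      by [].
    by [].
  case E: dir hQ fs => // hQ fs _; eapply runs_leT.
    eapply (runs_seq (T1 := 2) (T2 := 2) (Q1 := fun s => s = St cnt q h f v w p ok key j x mem (rcons out q)));
      [apply: runs_write => //|].
      by rewrite /write /= E.
    move=> s1 fs1 E1; rewrite E1 in fs1 *; apply: runs_write => //=.
    rewrite E in fs1 *; move: hQ; rewrite /write /= -!cats1 -catA; apply.
    by [].
  by [].
by [].
Qed.

Lemma runs_visit q f v w p ok key j x mem st (H := nth finset.set0 st.1 q) :
  q < size st.1 -> explored B q 0 st -> pairs mem (fun v w => w \in cl1 B H v) ->
  faces_tree mem st.1 ->
  fits (St (size st.1) q (code H) f v w p ok key j x mem (arcs_out st.2)) ->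
  runs visit_prog (St (size st.1) q (code H) f v w p ok key j x mem (arcs_out st.2))
    (c * (220 * c + 150) + 12)
    (fun s' => exists v w p ok key j x mem', let st' := visits B q c st in
      [/\ s' = St (size st'.1) q (code H) f v w p ok key j x mem' (arcs_out st'.2),
      faces_tree mem' st'.1 & same_below mem mem']).
Proof.
move=> qs ex pm tr fs.
pose I t s := exists w p ok key j x mem', let st' := visits B q t st in
  [/\ s = St (size st'.1) q (code H) f t w p ok key j x mem' (arcs_out st'.2),
  faces_tree mem' st'.1 & same_below mem mem'].
eapply runs_leT.
  eapply runs_le; [apply: (runs_for (I := I) (n := c) (T := fun=> 220 * c + 130))| |] => //=.
  - by apply: small_ltW; lia.
  - by rewrite /I /visits take0; exists w, p, ok, key, j, x, mem.
  - by move=> k s [? [? [? [? [? [? [? [-> _ _]]]]]]]].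
  - move=> t s fst [w1 [p1 [ok1 [key1 [j1 [x1 [mem1 [E tr1 sb1]]]]]]]]; rewrite E in fst *.
    have [ext _] := explored_visits (ltnW (ltn_ord t)) qs ex.
    have [exS _] := explored_visits (ltn_ord t) qs ex.
    have [qst nst] := visits_nth (ltnW (ltn_ord t)) qs.
    have := visitsS B q t st; move: (explored_size exS); set st1 := visits B q t st in nst qst ext tr1 fst E *.
    set st2 := visits B q t.+1 st => sphi st2E.
    have pm1 : pairs mem1 (fun v w => w \in cl1 B H v).
      by move=> v' w'; rewrite sb1 ?pm // ltn_add2l pair_addr_lt.
    eapply runs_leT.
      apply: runs_seq (runs_select pm1 fst) _ => s1 fs1 E1; rewrite E1 in fs1 *.
      apply: (runs_if (T := 120 * c + 60)) => /=.
        case sel: (selects B H t) fs1 => // fs1 _.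
        have st2E' : st2 = (if cl1 B H t \in st1.1 then st1.1 else rcons st1.1 (cl1 B H t),
            rcons st1.2 (q, index (cl1 B H t) st1.1)).
          by rewrite st2E /visit nst -/H sel.
        have [[uS _] _ _ _ _] : explored B q t (st1.1, st1.2) by case: (st1) ext.
        have sphi' : size (if cl1 B H t \in st1.1 then st1.1 else rcons st1.1 (cl1 B H t)) <= phi.
          by move: sphi; rewrite st2E'.
        eapply runs_leT.
          apply: runs_seq (runs_find tr1 uS sphi' fs1) _ => s2 fs2 [p2 [x2 [mem2 [E2 tr2 sb2]]]].
          rewrite E2 in fs2 *; apply: runs_emit => // _; split=> //.
          do 7 eexists; rewrite /= -/st2 st2E' /= arcs_out_rcons; split; [by []|exact: tr2|].
          by move=> a atb; rewrite sb2 // sb1.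
        by lia.
      case sel: (selects B H t) fs1 => // fs1 _.
      have st2E' : st2 = st1 by rewrite st2E /visit nst -/H sel.
      eapply runs_leT.
        apply: runs_skip => //; first by rewrite /= expn_gt0.
        by split=> //; do 7 eexists; rewrite /= -/st2 st2E'; split; [by []|exact: tr1|exact: sb1].
      by lia.
    by rewrite /=; lia.
  move=> s' fs' [w1 [p1 [ok1 [key1 [j1 [x1 [mem1 h]]]]]]].
  by exists c, w1, p1, ok1, key1, j1, x1, mem1.
rewrite sum_nat_const card_ord /=; lia.
Qed.

Hypothesis closed0 : closed_set B finset.set0.

Definition nones := \sum_(f < r) row_weight f.

(** Clearing the pair matrix, cutting it down by the rows, then [c] selections and searches; the
    constants are rounded up. *)
Definition face_time := 30 * (c * c) + (r * (83 * c + 50) + nones * (50 * c + 20)) +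
  c * (220 * c + 150) + 100.

Definition explore_inv q s := exists h f v w p ok key j x mem, let st := explore B q in
  [/\ s = St (size st.1) q h f v w p ok key j x mem (arcs_out st.2),
   q <= size st.1 /\ explored B q 0 st, entries mem & faces_tree mem st.1].

Lemma runs_face q s : fits s -> q < size (explore B q).1 -> explore_inv q s ->
  runs face_prog s face_time (explore_inv q.+1).
Proof.
move=> fs + [h [f [v [w [p [ok [key [j [x [mem [E [_ ex] em tr]]]]]]]]]]].
move: fs; rewrite E; set st := explore B q => fs qs; rewrite -/st in ex tr.
have sphi : size st.1 <= phi by exact: explored_size ex.
set H := nth finset.set0 st.1 q.
have hE : cell mem (tb + 3 * q) = code H.
  have [gk _ _ _] := tr; rewrite gk ?size_map //.
  by rewrite (nth_map finset.set0).
have small_cell mem1 mem2 : same_off mem1 mem2 -> faces_tree mem1 st.1 -> faces_tree mem2 st.1.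
  move=> so; rewrite /faces_tree; congr tree; apply/funext => a; rewrite so //.
  by rewrite leq_addr orbT.
eapply runs_leT.
  eapply runs_assign_seq => //=; first by rewrite hE; exact: ltn_trans (code_lt _) c_ltW.
  rewrite hE => {}fs; apply: runs_seq (runs_init fs) _ => s1 fs1 [mem1 [E1 so1 pm1]].
  rewrite E1 in fs1 *; have em1 := entries_same_off so1 em; have tr1 := small_cell _ _ so1 tr.
  apply: runs_seq (runs_rows em1 pm1 fs1) _ => s2 fs2 [v2 [w2 [ok2 [x2 [mem2 [E2 so2 pm2]]]]]].
  rewrite E2 in fs2 *; have em2 := entries_same_off so2 em1; have tr2 := small_cell _ _ so2 tr1.
  apply: runs_seq (runs_visit qs ex pm2 tr2 fs2) _ => s3 fs3.
  move=> [v3 [w3 [p3 [ok3 [key3 [j3 [x3 [mem3 [E3 tr3 sb3]]]]]]]]].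
  rewrite E3 in fs3 *; apply: runs_assign => //=.
    by apply: small_ltW; rewrite /mem_size; lia.
  rewrite addn1.
  have [ex3 s3le] := explored_visits (leqnn c) qs ex.
  do 10 eexists; split; first by [].
  - split; first exact: leq_trans qs s3le.
    exact: explored_next.
  - by move=> g u; rewrite sb3 ?em2 //; apply: leq_trans (leq_addr _ _); rewrite ltn_add2l addr.
  - exact: tr3.
rewrite /face_time /nones /=; lia.
Qed.

Lemma runs_explore f v w p ok key j x cnt q h mem :
  entries mem -> (forall a, cell mem (tb + a) = 0) -> 0 < phi ->
  fits (St cnt q h f v w p ok key j x mem [::]) ->
  runs explore_prog (St cnt q h f v w p ok key j x mem [::])
    (phi * (face_time + 6) + 20)
    (fun s => exists st q, [/\ explored B q 0 st, size st.1 = q &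
      output s = rcons (arcs_out st.2) q]).
Proof.
move=> em m0 phi0 fs.
have ex0 : explored B 0 0 (explore B 0) by exact: explored_explore.
eapply runs_leT.
  eapply runs_assign_seq => //=; first by apply: small_ltW; lia.
  move=> {}fs; eapply runs_assign_seq => //=; first by rewrite expn_gt0.
  move=> {}fs.
  eapply runs_seq.
    (* [phi] is the variant: a true guard means that [q] is below the number of sets found, which is
       at most [phi]. *)
    apply: (runs_while (n := phi) (I := explore_inv) (T := fun=> face_time) _ fs (leq0n _)).
      move=> k s fs1 inv; have [h1 [f1 [v1 [w1 [p1 [ok1 [key1 [j1 [x1 [mem1 [E [_ ex1] _ _]]]]]]]]]]] := inv.
      rewrite {1}E /= addn1 eqb0 negbK => ks; split.
        exact: leq_trans ks (explored_size ex1).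
      exact: runs_face.
    do 10 eexists; split; [by []|by []|exact: em|].
    (* The untouched zero cells already form a tree: the empty set has code 0, so they are a root
       with its key and no children. *)
    by rewrite /faces_tree /= code0; apply: tree0.
  move=> s1 fs1 [k [_ inv]]; have [h1 [f1 [v1 [w1 [p1 [ok1 [key1 [j1 [x1 [mem1 [E [kle ex1] _ _]]]]]]]]]]] := inv.
  rewrite E in fs1 * => /= guard; apply: runs_write => //=.
  exists (explore B k), k; split=> //; last congr (rcons _ _).
    by apply/eqP; rewrite eqn_leq kle andbT leqNgt; apply/negP => lt; move: guard; rewrite addn1 lt.
  by apply/eqP; rewrite eqn_leq kle andbT leqNgt; apply/negP => lt; move: guard; rewrite addn1 lt.
by rewrite big_const_nat iter_addn subn0 /=; lia.
Qed.

Lemma runs_setup m n mem :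
  cell mem 0 = m -> cell mem 1 = n ->
  (if dir then [/\ m < n, r = n, c = m, sr = 1 & sc = n]
   else [/\ n <= m, r = m, c = n, sr = n & sc = 1]) ->
  fits (State [::] mem [::]) ->
  runs setup_prog (State [::] mem [::]) 70
    (fun s => s = St 0 0 0 0 0 0 0 0 0 0 0 mem [::]).
Proof.
move=> m0 n1 dirE fs.
have rW : r < 2 ^ W by apply: small_ltW; lia.
have cW' : c < 2 ^ W by apply: small_ltW; lia.
have W0 : 0 < 2 ^ W by rewrite expn_gt0.
have W1 : 1 < 2 ^ W by apply: small_ltW; lia.
have kbW : kb < 2 ^ W by apply: small_ltW; rewrite /mem_size /tree_base; lia.
have tbW : tb < 2 ^ W by apply: small_ltW; rewrite /mem_size; lia.
eapply runs_leT.
  (* [rX] is the last register: assigning it first pads the register sequence to its full length. *)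
  eapply runs_assign_seq => //= {}fs.
  apply: (runs_seq (T1 := 30) (T2 := 30)
    (Q1 := fun s => s = State [:: r; c; sr; sc; 0; 0; nat_of_bool dir; 0; 0; 0; 0; 0; 0; 0; 0; 0; 0; 0] mem [::])).
    eapply runs_leT.
      apply: (runs_if (T := 20)) => /=; rewrite m0 n1 => guard.
        have nm : n <= m by move: guard; case: (n <= m).
        case: dir dirE => [[mn]|[_ rm cn srn sc1]]; first by rewrite leqNgt mn in nm.
        eapply runs_leT.
          eapply runs_assign_seq => //=; first by rewrite m0 -rm.
          move=> {}fs; eapply runs_assign_seq => //=; first by rewrite n1 -cn.
          move=> {}fs; eapply runs_assign_seq => //=; first by rewrite n1 -cn.
          move=> {}fs; eapply runs_assign_seq => //= {}fs.
          by apply: runs_assign => //=; rewrite m0 n1 rm cn srn sc1.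
        by [].
      have nm : m < n by move: guard; rewrite ltnNge; case: (n <= m).
      case: dir dirE => [[_ rm cn srn sc1]|[mn]]; last by rewrite leqNgt nm in mn.
      eapply runs_leT.
        eapply runs_assign_seq => //=; first by rewrite n1 -rm.
        move=> {}fs; eapply runs_assign_seq => //=; first by rewrite m0 -cn.
        move=> {}fs; eapply runs_assign_seq => //= {}fs.
        eapply runs_assign_seq => //=; first by rewrite n1 -rm.
        move=> {}fs.
        by apply: runs_assign => //=; rewrite m0 n1 rm cn srn sc1.
      by [].
    by [].
  move=> s1 fs1 E1; rewrite E1 in fs1 *.
  eapply runs_leT.
    eapply runs_assign_seq => //= fs2.
    by apply: runs_assign.
  by [].
by [].
Qed.

Definition total_time := phi * (face_time + 6) + 90.

Lemma runs_hasse m n mem :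
  cell mem 0 = m -> cell mem 1 = n ->
  (if dir then [/\ m < n, r = n, c = m, sr = 1 & sc = n]
   else [/\ n <= m, r = m, c = n, sr = n & sc = 1]) ->
  entries mem -> (forall a, cell mem (tb + a) = 0) ->
  fits (State [::] mem [::]) ->
  runs hasse_prog (State [::] mem [::]) total_time
    (fun s => exists st q, [/\ explored B q 0 st, size st.1 = q &
      output s = rcons (arcs_out st.2) q]).
Proof.
move=> m0 n1 dirE em mem0 fs; eapply runs_leT.
  apply: runs_seq (runs_setup m0 n1 dirE fs) _ => s1 fs1 E1; rewrite E1 in fs1 *.
  apply: runs_explore => //.
  by rewrite phiE; apply/card_gt0P; exists finset.set0.
by rewrite /total_time; lia.
Qed.

(** * Time and space bounds *)

Hypotheses (c_phi : c <= phi) (r_phi : r <= phi) (cr : c <= r).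
Hypothesis nones_ge : r <= nones \/ r <= 1.

Lemma nones_le : nones <= r * c.
Proof.
rewrite /nones -[X in X * c]card_ord -sum_nat_const leq_sum // => f _.
rewrite /row_weight -[X in _ <= X]card_ord -sum1_card leq_sum // => v _.
exact: leq_b1.
Qed.

(** From [c <= r <= nones], each term of [face_time] is at most a multiple of [c * nones]. If
    [r <= 1], then [nones] may be 0, but [c <= 1] and [phi <= 2] bound the time by a number; of the
    two cases this one needs the larger constant. *)
Lemma total_time_le : total_time <= 2000 * maxn 1 (c * nones * phi).
Proof.
clear addr cW sizeW closed0.
have pc := phi_le; have nle := nones_le; rewrite /total_time /face_time.
have [r1|r2] := leqP r 1.
  have c1 : c <= 1 by exact: leq_trans cr r1.
  have p2 : phi <= 2 by apply: leq_trans pc _; rewrite -[leqRHS]expn1 leq_exp2l.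
  have n1 : nones <= 1 by apply: leq_trans nle _; rewrite -[leqRHS]mul1n leq_mul.
  apply: (@leq_trans 2000); last by rewrite leq_pmulr // leq_maxl.
  have cc : c * c <= 1 by rewrite -[leqRHS]mul1n leq_mul.
  have h1 : r * (83 * c + 50) <= 1 * (83 * 1 + 50) by rewrite leq_mul // leq_add2r leq_mul2l.
  have h2 : nones * (50 * c + 20) <= 1 * (50 * 1 + 20) by rewrite leq_mul // leq_add2r leq_mul2l.
  have h3 : c * (220 * c + 150) <= 1 * (220 * 1 + 150) by rewrite leq_mul // leq_add2r leq_mul2l.
  set ft := _ + 100; have : ft + 6 <= 709 by rewrite /ft; lia.
  move=> h; apply: (@leq_trans (2 * 709 + 90)) => //.
  by rewrite leq_add2r leq_mul.
have rn : r <= nones by case: nones_ge => //; lia.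
have n1 : 0 < nones by lia.
have c1 : 0 < c by case: (posnP c) => // c0; move: nle; rewrite c0 muln0; lia.
have p1 : 0 < phi by exact: leq_trans c1 c_phi.
set X := c * nones.
have X1 : 1 <= X by rewrite /X muln_gt0 c1.
have h1 : c * c <= X by rewrite leq_mul // (leq_trans cr).
have h2 : r * c <= X by rewrite mulnC leq_mul.
have h3 : r <= X by apply: leq_trans rn _; rewrite /X leq_pmull.
have h4 : nones <= X by rewrite /X leq_pmull.
have h5 : c <= X by rewrite /X leq_pmulr.
have -> : 30 * (c * c) + (r * (83 * c + 50) + nones * (50 * c + 20)) + c * (220 * c + 150) + 100 =
   250 * (c * c) + 83 * (r * c) + 50 * r + 50 * X + 20 * nones + 150 * c + 100.
  by rewrite /X; lia.
set ft := _ + 100; have hft : ft + 6 <= 809 * X by rewrite /ft; lia.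
apply: (@leq_trans (2000 * (X * phi))); last by rewrite leq_mul2l leq_maxr orbT.
have : phi * (ft + 6) <= phi * (809 * X) by rewrite leq_mul2l hft orbT.
have : 1 <= X * phi by rewrite muln_gt0 X1.
rewrite [phi * (809 * X)]mulnCA [phi * X]mulnC; lia.
Qed.

(** The register width [W] is a wasteful choice, but [mem_size] is itself [O(phi * c)], as [r] and
    [c] are at most [phi]; a fixed number of registers and the two input dimensions can afford
    it. *)
Lemma space_le : W = mem_size + r + c + 4 ->
  space W mem_size cell_bound <= 2000 * maxn 1 (phi * c).
Proof.
clear addr cW sizeW closed0; move=> WE.
have kb2 : 2 <= tb by rewrite /tree_base /pair_base; lia.
have tZ : tb <= mem_size by exact: leq_addr.
have -> : space W mem_size cell_bound = 18 * W.+1 + (2 * W.+1 + (r * c + c * c) * 2 + 3 * phi * c.+1).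
  rewrite /space; congr (_ + _); rewrite -(big_mkord xpredT (fun a => (cell_bound a).+1)).
  rewrite (big_cat_nat (leq0n 2) (leq_trans kb2 tZ)) (big_cat_nat kb2 tZ) /= addnA.
  congr (_ + _ + _).
  - by rewrite (eq_big_nat _ _ (F2 := fun=> W.+1)) ?sum_nat_const_nat // => a; rewrite /cell_bound => /andP[_ ->].
  - rewrite (eq_big_nat _ _ (F2 := fun=> 2)) ?sum_nat_const_nat /tree_base /pair_base ?subSS ?subn0 -?addnA ?addKn //.
    by move=> a /andP[a2 at']; rewrite /cell_bound ltnNge a2 at'.
  - rewrite (eq_big_nat _ _ (F2 := fun=> c.+1)) ?sum_nat_const_nat ?addKn // => a /andP[ta _].
    by rewrite cell_bound_tree.
have pc := phi_le; have nle := nones_le.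
rewrite WE /mem_size /tree_base /pair_base.
have [c0|c1] := posnP c.
  apply: (@leq_trans 2000); last by rewrite leq_pmulr // leq_maxl.
  have p1 : phi <= 1 by apply: leq_trans pc _; rewrite c0.
  have : r <= 1 by case: nones_ge => //; move: nle; rewrite c0 muln0; lia.
  by rewrite c0 !muln0 muln1; lia.
apply: (@leq_trans (2000 * (phi * c))); last by rewrite leq_mul2l leq_maxr orbT.
have h1 : r * c <= phi * c by rewrite leq_mul2r r_phi orbT.
have h2 : c * c <= phi * c by rewrite leq_mul2r c_phi orbT.
have h3 : phi <= phi * c by rewrite leq_pmulr.
have h4 : 1 <= phi * c by rewrite muln_gt0 c1 (leq_trans c1 c_phi).
have -> : 3 * phi * c.+1 = 3 * (phi * c) + 3 * phi by lia.
lia.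
Qed.

End Program.

(** * The input in memory *)

Lemma nth_allpairs_ord (T S : Type) (x0 : T) (f : S -> nat -> T) n (s : seq S) i j :
  j < n -> forall y0, i < size s ->
  nth x0 [seq f x y | x <- s, y <- iota 0 n] (i * n + j) = f (nth y0 s i) j.
Proof.
move=> jn y0; elim: s i => // x s IHs [|i] /=; rewrite nth_cat size_map size_iota.
  by rewrite mul0n add0n jn => _; rewrite (nth_map 0) ?size_iota // nth_iota.
rewrite ltnS mulSn -addnA addKn => si.
by rewrite ifF ?IHs //; apply/negbTE; rewrite -leqNgt leq_addr.
Qed.

Section Input.
Variables (m n : nat) (A : 'M[bool]_(m, n)).
Let mem := memory (input_state A).

Lemma size_input : size mem = 2 + m * n.
Proof. by rewrite /mem /= size_allpairs !size_enum_ord. Qed.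

Lemma nth_input (i : 'I_m) (j : 'I_n) : nth 0 mem (2 + (i * n + j)) = A i j.
Proof.
rewrite /mem /=.
have n0 : 0 < n by exact: leq_ltn_trans (leq0n j) (ltn_ord j).
have -> : [seq nat_of_bool (A i0 j0) | i0 <- enum 'I_m, j0 <- enum 'I_n] =
    [seq (if insub y is Some k then nat_of_bool (A x k) else 0) | x <- enum 'I_m, y <- iota 0 n].
  rewrite -val_enum_ord allpairs_mapr; apply: eq_allpairs => // x y.
  by rewrite valK.
rewrite (nth_allpairs_ord _ _ (ltn_ord j) i) ?size_enum_ord // nth_ord_enum.
by rewrite valK.
Qed.

Lemma input_le1 a : 2 <= a -> nth 0 mem a <= 1.
Proof.
move=> a2; have [am|am] := ltnP a (size mem); last by rewrite nth_default.
have : nth 0 mem a \in [seq nat_of_bool (A i0 j0) | i0 <- enum 'I_m, j0 <- enum 'I_n].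
  case: a a2 am => [|[|a]] // _; rewrite /mem /= !ltnS => am; exact: mem_nth.
by move=> /allpairsP[[i j] [_ _ ->]]; exact: leq_b1.
Qed.

End Input.

(** * Faces of polyhedra *)

Local Open Scope classical_set_scope.
Local Open Scope ring_scope.

Local Notation dim := Defs.dim.

Section Polyhedron.
Variables (R : realType) (d k : nat) (M : 'M[R]_(k, d)) (b : 'cV[R]_k).
Implicit Types (x y z u w q : 'cV[R]_d) (a : 'rV[R]_d) (F G H K : set 'cV[R]_d).

Definition pol : set 'cV[R]_d := [set x | forall i, (M *m x) i 0 <= b i 0].

Definition tight x : {set 'I_k} := [set i | (M *m x) i 0 == b i 0].

Lemma dotD a x y : (a *m (x + y)) 0 0 = (a *m x) 0 0 + (a *m y) 0 0.
Proof. by rewrite mulmxDr mxE. Qed.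

Lemma dotB a x y : (a *m (x - y)) 0 0 = (a *m x) 0 0 - (a *m y) 0 0.
Proof. by rewrite mulmxBr !mxE. Qed.

Lemma dotZ a t x : (a *m (t *: x)) 0 0 = t * (a *m x) 0 0.
Proof. by rewrite -scalemxAr mxE. Qed.

Lemma rowD i x y : (M *m (x + y)) i 0 = (M *m x) i 0 + (M *m y) i 0.
Proof. by rewrite mulmxDr mxE. Qed.

Lemma rowB i x y : (M *m (x - y)) i 0 = (M *m x) i 0 - (M *m y) i 0.
Proof. by rewrite mulmxBr !mxE. Qed.

Lemma rowZ i t x : (M *m (t *: x)) i 0 = t * (M *m x) i 0.
Proof. by rewrite -scalemxAr mxE. Qed.

Lemma tightP x i : reflect ((M *m x) i 0 = b i 0) (i \in tight x).
Proof. by rewrite inE; exact: eqP. Qed.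

Lemma slack x i : pol x -> i \notin tight x -> (M *m x) i 0 < b i 0.
Proof. by move=> Px; rewrite inE lt_neqAle => ->; exact: Px. Qed.

Lemma small_step x u : pol x -> (forall i, i \in tight x -> (M *m u) i 0 <= 0) ->
  exists2 e, 0 < e & pol (x + e *: u).
Proof.
move=> Px Hu.
(* For a slack constraint, a step length that keeps it valid; adding 1 to the absolute value avoids
   a division by zero. Tight constraints do not limit the step. *)
pose f i := if i \in tight x then 1 else (b i 0 - (M *m x) i 0) / (1 + `|(M *m u) i 0|).
have e0 : 0 < \big[Num.min/1]_i f i.
  apply/lt_bigmin => // i _; rewrite /f; case: ifPn => // ni.
  by rewrite divr_gt0 ?subr_gt0 ?slack // ltr_pwDl.
exists (\big[Num.min/1]_i f i) => //.
set e := \big[_/_]_i _ in e0 *; move=> i; rewrite rowD rowZ.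
have [ti|ni] := boolP (i \in tight x).
  have := Hu _ ti; move/tightP: ti => ->.
  by move=> h; rewrite gerDl mulr_ge0_le0 // ltW.
have : e <= f i by apply: bigmin_le_cond.
rewrite /f (negPf ni) ler_pdivlMr ?ltr_pwDl // => h.
have : e * (M *m u) i 0 <= e * (1 + `|(M *m u) i 0|).
  by rewrite ler_pM2l //; have := ler_norm ((M *m u) i 0); lra.
by lra.
Qed.

(** The ratio test of the simplex method: the least ratio of slack to speed is the step length. [J]
    is the set of all constraints for a walk inside the polytope, and that of the constraints tight
    at a point for a walk in its cone. *)
Lemma exit_step w u (J : {set 'I_k}) :
  (forall i, i \in J -> (M *m w) i 0 <= b i 0) ->
  (exists2 i, i \in J & 0 < (M *m u) i 0) ->
  exists t, [/\ 0 <= t, forall i, i \in J -> (M *m (w + t *: u)) i 0 <= b i 0 &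
    exists i, [/\ i \in J, 0 < (M *m u) i 0 & i \in tight (w + t *: u)]].
Proof.
move=> Pw [i1 i1J i1u].
pose f i := (b i 0 - (M *m w) i 0) / (M *m u) i 0.
have i1P : (i1 \in J) && (0 < (M *m u) i1 0) by rewrite i1J.
case: (@arg_minP _ _ _ i1 [pred i | (i \in J) && (0 < (M *m u) i 0)] f i1P) => i /= /andP[iJ iu] imin.
have t0 : 0 <= f i by rewrite divr_ge0 ?subr_ge0 ?Pw // ltW.
exists (f i); split => //.
  move=> j jJ; rewrite rowD rowZ.
  have [ju|ju] := ltrP 0 ((M *m u) j 0).
    have /imin : (j \in J) && (0 < (M *m u) j 0) by rewrite jJ.
    by rewrite {2}/f ler_pdivlMr //; lra.
  have := mulr_ge0_le0 t0 ju; have := Pw _ jJ; lra.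
exists i; split => //; apply/tightP; rewrite rowD rowZ /f divfK ?gt_eqF //; lra.
Qed.

(** The smallest face containing [x], as [min_face_sub] shows; by [faceP] all nonempty faces arise
    this way. *)
Definition min_face x : set 'cV[R]_d := [set y | pol y /\ tight x \subset tight y].

Lemma min_face_refl x : pol x -> min_face x x.
Proof. by []. Qed.

(** The sum of the inequalities tight at [x] exposes it: equality in the sum forces equality in each
    of them. *)
Lemma min_face_face x : is_face pol (min_face x).
Proof.
exists (\sum_(i in tight x) row i M), (\sum_(i in tight x) b i 0).
have dot y : (((\sum_(i in tight x) row i M) : 'rV_d) *m y) 0 0 = \sum_(i in tight x) (M *m y) i 0.
  rewrite mulmx_suml summxE; apply: eq_bigr => i _.
  by rewrite -row_mul mxE.
split=> [y Py|]; first by rewrite dot ler_sum.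
apply/seteqP; split=> y /= [Py].
  move=> /fintype.subsetP xy; split=> //; rewrite dot; apply: eq_bigr => i /xy /tightP //.
rewrite dot => /eqP; rewrite eq_le => /andP[_ le]; split=> //.
apply/fintype.subsetP => i ix; apply/negPn/negP => niy.
move: le; rewrite leNgt => /negP; apply.
rewrite (bigD1 i) //= [X in _ < X](bigD1 i) //= ltr_leD ?slack // ler_sum //.
Qed.

Lemma pol_mid x y : pol x -> pol y -> pol (2^-1 *: (x + y)).
Proof.
move=> Px Py i; rewrite rowZ rowD; have := Px i; have := Py i; lra.
Qed.

Lemma tight_mid x y : pol x -> pol y -> tight (2^-1 *: (x + y)) = tight x :&: tight y.
Proof.
move=> Px Py; apply/finset.setP => i; rewrite !inE rowZ rowD; have := Px i; have := Py i.
move=> iy ix; apply/idP/andP => [/eqP h|[/eqP-> /eqP->]]; last by apply/eqP; lra.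
by split; apply/eqP; lra.
Qed.

(** Take [x] in [F] with the fewest tight constraints. The midpoint of [x] and [y] in [F] has as
    tight constraints those common to both, so minimality makes all constraints tight at [x] tight
    at [y]. *)
Lemma faceP F : is_face pol F -> F = set0 \/ exists2 x, pol x & F = min_face x.
Proof.
move=> [a [c [Pa EF]]]; have FP y : F y <-> pol y /\ (a *m y) 0 0 = c by rewrite EF.
have [[x0 Fx0]|] := pselect (exists x, F x); last first.
  by move=> h; left; rewrite -subset0 => x Fx; apply: h; exists x.
right.
have ex : exists n, `[< exists2 x, F x & #|tight x| = n >].
  by exists #|tight x0|; apply/asboolP; exists x0.
case: (ex_minnP ex) => n /asboolP[x Fx xn] nmin.
have /FP[Px ax] := Fx.
exists x => //.
apply/seteqP; split=> y.
  move=> Fy; have /FP[Py ay] := Fy; split=> //.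
  have Fm : F (2^-1 *: (x + y)).
    apply/FP; split; first exact: pol_mid.
    by rewrite dotZ dotD ax ay; lra.
  have /nmin : `[< exists2 z, F z & #|tight z| = #|tight x :&: tight y| >].
    by apply/asboolP; exists (2^-1 *: (x + y)); rewrite // tight_mid.
  rewrite -xn => le; apply/finset.setIidPl/eqP.
  by rewrite eqEcard finset.subsetIl le.
move=> [Py /fintype.subsetP xy]; apply/FP; split=> //.
(* Pushing [x] slightly away from [y] stays in [pol]; if [a] were below [c] at [y], it would exceed
   [c] at the new point. *)
have [] := @small_step x (x - y) Px.
  move=> i ti; rewrite rowB.
  by move: (xy _ ti) => /tightP ->; move/tightP: ti => ->; rewrite subrr.
move=> e e0 /Pa; rewrite dotD dotZ dotB ax.
have := Pa _ Py; rewrite le_eqVlt => /predU1P[//|lt] h.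
have : 0 < e * (c - (a *m y) 0 0) by rewrite mulr_gt0 // subr_gt0.
lra.
Qed.


Lemma min_face_ex x u : pol x -> (forall i, i \in tight x -> (M *m u) i 0 = 0) ->
  exists2 e, 0 < e & min_face x (x + e *: u).
Proof.
move=> Px Hu; case: (@small_step x u Px) => [i /Hu -> //|e e0 Pe].
exists e => //; split=> //; apply/fintype.subsetP => i ix; apply/tightP.
by rewrite rowD rowZ Hu // mulr0 addr0; exact/tightP.
Qed.

(** * Dimension of faces *)

Definition tight_mx x : 'M[R]_(k, d) :=
  \matrix_(i, j) if i \in tight x then M i j else 0.

(** For [x] in [pol], the direction space of the affine hull of [min_face x], written as a kernel to
    make its dimension available. *)
Definition dirs x : {vspace 'cV[R]_d} := lker (linfun (mulmx (tight_mx x))).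

Lemma dirsP x u :
  reflect (forall i, i \in tight x -> (M *m u) i 0 = 0) (u \in dirs x).
Proof.
have E i : (tight_mx x *m u) i 0 = if i \in tight x then (M *m u) i 0 else 0.
  rewrite mxE; case: ifPn => ix.
    by rewrite mxE; apply: eq_bigr => j _; rewrite mxE ix.
  by rewrite big1 // => j _; rewrite mxE (negPf ix) mul0r.
rewrite /dirs memv_ker lfunE /=; apply: (iffP eqP) => [h i ix|h].
  by move: (E i); rewrite h ix mxE => ->.
by apply/matrixP => i j; rewrite ord1 E [RHS]mxE; case: ifP => [ix|//]; exact: h.
Qed.

Lemma dirs_min_face x y z : min_face x y -> min_face x z -> y - z \in dirs x.
Proof.
move=> [_ /fintype.subsetP xy] [_ /fintype.subsetP xz]; apply/dirsP => i ix.
by rewrite rowB; move/xy: (ix) => /tightP ->; move/xz: ix => /tightP ->; rewrite subrr.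
Qed.

(** Affinely independent points of the face have linearly independent differences in [dirs x].
    Conversely, [x] and short steps from it along a basis of [dirs x] are affinely independent
    points of the face. *)
Lemma dim_min_face x : pol x -> dim (min_face x) = (\dim (dirs x))%:Z.
Proof.
move=> Px; rewrite /dim; suff -> : (\max_(n < d.+2 | `[< exists p : 'I_n -> 'cV[R]_d,
      (forall i, min_face x (p i)) /\ affinely_independent p >]) n = (\dim (dirs x)).+1)%N.
  by rewrite -addn1 PoszD addrK.
apply/eqP; rewrite eqn_leq; apply/andP; split.
  apply/bigmax_leqP => -[n /= _] /asboolP[p [Fp pI]].
  case: n p Fp pI => // n p Fp pI; rewrite ltnS.
  pose X := [tuple p (lift ord0 j) - p ord0 | j < n].
  have XE (j : 'I_n) : X`_j = p (lift ord0 j) - p ord0 by rewrite nth_mktuple.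
  have freeX : free X.
    apply/freeP => l l0 j.
    (* The coefficient of the base point is chosen to make the sum vanish, turning a linear relation
       between differences into an affine one. *)
    pose l' i := oapp l (- \sum_j l j) (unlift ord0 i).
    have l'0 : l' ord0 = - \sum_j l j by rewrite /l' unlift_none.
    have l'S i : l' (lift ord0 i) = l i by rewrite /l' liftK.
    rewrite -l'S; apply: pI.
      by rewrite big_ord_recl l'0; under [X in _ + X]eq_bigr do rewrite l'S; rewrite addNr.
    rewrite big_ord_recl l'0 -[RHS]l0; under [X in _ + X]eq_bigr do rewrite l'S.
    rewrite scaleNr scaler_suml -sumrN -big_split /=.
    by apply: eq_bigr => i _; rewrite XE scalerBr addrC.
  have := size_tuple X; rewrite -(eqP freeX) => <-.
  apply/dimvS/span_subvP => u /tnthP[j ->].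
  by rewrite tnth_mktuple dirs_min_face.
set r := \dim (dirs x); set X := vbasis (dirs x).
(* The maximum in [dim] ranges over fewer than [d + 2] points, so [r + 1] has to be an admissible
   index. *)
have rd : (r <= d)%N.
  have := dimvS (subvf (dirs x)); rewrite dimvf dim_matrix mulr1.
  by [].
have e_ex (j : 'I_r) : exists e, 0 < e /\ min_face x (x + e *: X`_j).
  have [|e e0 he] := @min_face_ex x X`_j Px; last by exists e.
  by apply/dirsP/vbasis_mem/mem_nth; rewrite size_tuple.
have [e he] := choice e_ex.
pose p (i : 'I_r.+1) := oapp (fun j => x + e j *: X`_j) x (unlift ord0 i).
have rd2 : (r.+1 < d.+2)%N by [].
rewrite -[r.+1]/(val (Ordinal rd2)); apply: leq_bigmax_cond.
apply/asboolP; exists p; split=> /=.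
  by move=> i; rewrite /p; case: (unlift _ _) => //= j; have [] := he j.
move=> l l0 lp0.
have p0 : p ord0 = x by rewrite /p unlift_none.
have pS j : p (lift ord0 j) = x + e j *: X`_j by rewrite /p liftK.
have lS j : l (lift ord0 j) = 0.
  have h0 : \sum_(i < r) (l (lift ord0 i) * e i) *: X`_i = 0.
    have : \sum_i l i *: p i - (\sum_i l i) *: x = 0 by rewrite l0 lp0 scale0r subrr.
    rewrite scaler_suml -sumrB big_ord_recl p0 subrr add0r => h.
    rewrite -[RHS]h; apply: eq_bigr => i _.
    by rewrite pS scalerDr addrAC subrr add0r scalerA.
  have /freeP/(_ _ h0 j) := basis_free (vbasisP (dirs x)).
  by move/eqP; rewrite mulf_eq0 (gt_eqF (he j).1) orbF => /eqP.
move=> i; case: (unliftP ord0 i) => [j ->|->] //.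
by move: l0; rewrite big_ord_recl big1 ?addr0.
Qed.

Lemma dim_set0 : dim (set0 : set 'cV[R]_d) = -1.
Proof.
rewrite /dim (_ : (\max_(_ < _ | _) _)%N = 0%N) //.
apply/eqP; rewrite -leqn0; apply/bigmax_leqP => -[[|n] /= _] // /asboolP[p [/(_ ord0)]].
by [].
Qed.

Lemma min_faceS x y : pol y -> (min_face y `<=` min_face x <-> tight x \subset tight y).
Proof.
move=> Py; split=> [/(_ y) []//|xy z [Pz yz]].
by split=> //; exact: fintype.subset_trans yz.
Qed.

Lemma dim_face_ge0 F : is_face pol F -> F !=set0 -> 0 <= dim F.
Proof.
by move=> /faceP[-> [x]//|[x Px ->] _]; rewrite dim_min_face.
Qed.

Lemma dirs_proper x y : pol x -> pol y -> min_face x `<` min_face y ->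
  (dirs x <= dirs y)%VS /\ exists2 u, u \in dirs y & u \notin dirs x.
Proof.
move=> Px Py [sub] nsub.
have /fintype.subsetP yx := (min_faceS y Px).1 sub.
split; first by apply/subvP => u /dirsP h; apply/dirsP => i /yx; exact: h.
exists (y - x); first exact: dirs_min_face (min_face_refl Py) (sub _ (min_face_refl Px)).
apply/negP => /dirsP h; apply: nsub; apply/(min_faceS x Py)/fintype.subsetP => i ix.
apply/tightP; have := h _ ix; rewrite rowB; move/tightP: ix => ->; lra.
Qed.

Lemma dim_proper F G : is_face pol F -> is_face pol G -> F `<` G -> dim F < dim G.
Proof.
move=> /faceP[->|[x Px ->]] fG FG.
  have : G !=set0 by apply/set0P; apply/eqP => G0; case: FG; rewrite G0.
  by move/(dim_face_ge0 fG); rewrite dim_set0; lra.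
have [G0|[y Py G0]] := faceP fG; first by case: FG => /(_ x (min_face_refl Px)); rewrite G0.
move: FG; rewrite G0 => /(dirs_proper Px Py)[sub [u uy ux]].
rewrite !dim_min_face // ltz_nat ltn_neqAle dimvS // andbT.
have := (dimv_leqif_eq sub).2 => ->.
by apply: contraNneq ux => ->.
Qed.

Lemma dim_subset F G : is_face pol F -> is_face pol G -> F `<=` G -> dim F <= dim G.
Proof.
move=> fF fG FG; have [GF|nGF] := pselect (G `<=` F).
  by have -> : F = G by exact/seteqP.
exact/ltW/dim_proper.
Qed.

Lemma face_subset F : is_face pol F -> F `<=` pol.
Proof. by move=> [a [c [_ ->]]] x []. Qed.

Lemma face_setT : is_face pol pol.
Proof.
exists 0, 0; split=> [x _|]; first by rewrite mul0mx mxE.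
by apply/seteqP; split=> x; [move=> Px; split=> //=; rewrite mul0mx mxE|case].
Qed.

Lemma face_set0 : is_face pol set0.
Proof.
exists 0, 1; split=> [x _|]; first by rewrite mul0mx mxE ler01.
by apply/seteqP; split=> x // [_] /=; rewrite mul0mx mxE => /esym/eqP; rewrite oner_eq0.
Qed.

Lemma faceI F G : is_face pol F -> is_face pol G -> is_face pol (F `&` G).
Proof.
move=> [a [c [Pa ->]]] [a' [c' [Pa' ->]]]; exists (a + a'), (c + c').
have E x : ((a + a') *m x) 0 0 = (a *m x) 0 0 + (a' *m x) 0 0 by rewrite mulmxDl mxE.
split=> [x Px|]; first by rewrite E lerD ?Pa ?Pa'.
apply/seteqP; split=> x /=.
  by move=> [[Px /= h] [_ /= h']]; split=> //=; rewrite E h h'.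
move=> [Px]; rewrite /= E => h; have := Pa _ Px; have := Pa' _ Px.
by move=> h1 h2; split; split=> //=; lra.
Qed.

Lemma face_bigcap (I : finType) (D : {pred I}) (F : I -> set 'cV[R]_d) :
  (forall i, is_face pol (F i)) ->
  is_face pol (pol `&` [set x | forall i, i \in D -> F i x]).
Proof.
move=> fF; have -> : pol `&` [set x | forall i, i \in D -> F i x] =
    \big[setI/pol]_(i in D) F i.
  apply/seteqP; split=> x.
    move=> [Px Fx]; elim/big_ind: _ => // [|i /Fx//]; by move=> A B; split.
  have : (\big[setI/pol]_(i in D) F i) x ->
      pol x /\ forall i, i \in enum D -> F i x.
    rewrite -big_enum /=; elim: (enum D) => [|i s IHs]; first by rewrite big_nil.
    rewrite big_cons => -[Fi /IHs[Px h]]; split=> // j.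
    by rewrite in_cons => /predU1P[->//|/h].
  by move=> h /h[Px h']; split=> // i iD; apply: h'; rewrite mem_enum.
by elim/big_ind: _ => //; [exact: face_setT|exact: faceI].
Qed.


(** * Vertices, facets and covers of bounded polyhedra *)

Lemma bounded_exit y u : bounded_set pol -> pol y -> u != 0 ->
  exists i, 0 < (M *m u) i 0.
Proof.
move=> [B [_ /(_ (B + 1))]]; rewrite ltrDl ltr01 => /(_ isT) bP Py u0.
apply: contrapT => /forallNP nu.
have Pt t : 0 <= t -> pol (y + t *: u).
  move=> t0 i; rewrite rowD rowZ.
  have /negP := nu i; rewrite -leNgt => ui; have := mulr_ge0_le0 t0 ui; have := Py i; lra.
have nu0 : 0 < `|u| by rewrite normr_gt0.
(* If no constraint grew along [u], the ray from [y] would stay in [pol]; it would reach a point at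
   distance [2 * C + 1] from [y], impossible for two points of norm at most [C]. *)
pose C := Num.max 0 (B + 1).
have C0 : 0 <= C by rewrite le_max lexx.
have bC z : pol z -> `|z| <= C by move=> /bP h; rewrite le_max h orbT.
have := bC _ (Pt ((C + C + 1) / `|u|) _); have := bC _ Py.
have t0 : 0 <= (C + C + 1) / `|u| by rewrite divr_ge0 // ?normr_ge0 // !addr_ge0.
move=> hy /(_ t0) h.
have := ler_normB (y + ((C + C + 1) / `|u|) *: u) y.
rewrite addrAC subrr add0r normrZ ger0_norm // divfK ?gt_eqF //; lra.
Qed.

Lemma dirs_ltn y q : pol y -> pol q -> tight y \proper tight q ->
  (\dim (dirs q) < \dim (dirs y))%N.
Proof.
move=> Py Pq yq; rewrite -ltz_nat -!dim_min_face //; apply: dim_proper.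
- exact: min_face_face.
- exact: min_face_face.
split; first by apply/(min_faceS _ Pq); exact: proper_sub.
by move=> /(min_faceS _ Py); apply/negP; rewrite proper_subn.
Qed.

Lemma min_face_sub F y : is_face pol F -> F y -> min_face y `<=` F.
Proof. by move=> /faceP[->//|[x Px ->]] [Py]; move/(min_faceS _ Py). Qed.

(** Walk inside the face of [y] until a new constraint becomes tight; the dimension drops, and a
    vertex is reached in the end. With [G] empty this is the existence of vertices. *)
Lemma vertex_avoiding G y : bounded_set pol -> is_face pol G -> pol y -> ~ G y ->
  exists2 v, vertices pol v & v `<=` min_face y /\ ~ v `<=` G.
Proof.
move=> bP [a [c [Pa ->]]].
have [n] := ubnP (\dim (dirs y)); elim: n y => // n IHn y; rewrite ltnS => yn Py Gy.
have [d0|d0] := eqVneq (\dim (dirs y)) 0%N.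
  exists (min_face y); last by split=> // /(_ y (min_face_refl Py)).
  by split; [exact: min_face_face|rewrite dim_min_face // d0].
(* The sign of [u] is chosen so that [a] does not increase along it; the exit point then still
   misses [G]. *)
have [u [u0 uy ua]] : exists u, [/\ u != 0, u \in dirs y & (a *m u) 0 0 <= 0].
  pose u := vpick (dirs y).
  have u0 : u != 0 by rewrite vpick0 -dimv_eq0.
  have [h|h] := lerP ((a *m u) 0 0) 0; first by exists u; split=> //; exact: memv_pick.
  exists (- u); rewrite oppr_eq0 memvN; split=> //; first exact: memv_pick.
  by rewrite mulmxN mxE oppr_le0 ltW.
have [i ui] := bounded_exit bP Py u0.
have [t [t0 Pq [i0 [_ i0u i0q]]]] : exists t, [/\ 0 <= t,
    forall i, i \in [set: 'I_k]%SET -> (M *m (y + t *: u)) i 0 <= b i 0 &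
    exists i, [/\ i \in [set: 'I_k]%SET, 0 < (M *m u) i 0 & i \in tight (y + t *: u)]].
  by apply: exit_step => [j _|]; [exact: Py|exists i; rewrite ?inE].
have {}Pq : pol (y + t *: u) by move=> j; exact: Pq.
set q := y + t *: u in Pq i0q.
have yq : tight y \proper tight q.
  apply/properP; split.
    apply/fintype.subsetP => j jy; apply/tightP; rewrite rowD rowZ.
    by move/dirsP: uy => ->//; move/tightP: jy => ->; rewrite mulr0 addr0.
  by exists i0 => //; apply/negP => /(dirsP _ _ uy) h; move: i0u; rewrite h ltxx.
have Gq : ~ (pol `&` [set x | (a *m x) 0 0 = c]) q.
  move=> [_ /=]; rewrite dotD dotZ.
  have := mulr_ge0_le0 t0 ua => h1 h2; apply: Gy; split=> //=.
  have := Pa _ Py; lra.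
have [v v1 [v2 v3]] := IHn q (leq_trans (dirs_ltn Py Pq yq) yn) Pq Gq.
exists v => //; split=> //; apply: subset_trans v2 _.
by apply/(min_faceS _ Pq)/proper_sub.
Qed.

(* The faces above [min_face x] are those of the cone of feasible directions
   at [x]: moving from [w] along [u] until a constraint tight at [x] becomes
   tight, and pulling the point reached towards [x], leads to such a face. *)
Lemma cone_step x z w u a c : pol x ->
  (forall y, pol y -> (a *m y) 0 0 <= c) -> min_face x = pol `&` [set y | (a *m y) 0 0 = c] ->
  tight z \subset tight x -> min_face z w -> (a *m w) 0 0 < c ->
  u \in dirs z -> (a *m u) 0 0 = 0 -> u \notin dirs x ->
  exists y i, [/\ pol y, tight y \proper tight x, tight z \subset tight y,
    i \in tight y & 0 < (M *m u) i 0].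
Proof.
move=> Px Pa xE /fintype.subsetP zx [Pw /fintype.subsetP zw] aw /dirsP uz au ux.
have ax : (a *m x) 0 0 = c by have := min_face_refl Px; rewrite xE => -[].
(* Otherwise a short step from [x] along [u] stays in [pol], and in the face of [x] because [a]
   vanishes on [u]; then [u] would be one of its directions. *)
have : exists2 i, i \in tight x & 0 < (M *m u) i 0.
  apply: contrapT => nu; move/negP: ux; apply; apply/dirsP.
  have [i ix|e e0 Pe] := @small_step x u Px.
    by rewrite leNgt; apply/negP => ui; apply: nu; exists i.
  have [_ /fintype.subsetP xe] : min_face x (x + e *: u).
    by rewrite xE; split=> //=; rewrite dotD dotZ ax au mulr0 addr0.
  move=> i ix; move: (xe _ ix) => /tightP; rewrite rowD rowZ; move/tightP: ix => ->.
  move=> h; have /eqP : e * (M *m u) i 0 = 0 by lra.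
  by rewrite mulf_eq0 gt_eqF //= => /eqP.
move=> /(exit_step (w := w)) [i _|t [t0 tq [i0 [i0x i0u /tightP i0q]]]]; first exact: Pw.
set q := w + t *: u in tq i0q.
have aq : (a *m q) 0 0 = (a *m w) 0 0 by rewrite dotD dotZ au mulr0 addr0.
have [i ix|e e0] := @small_step x (q - x) Px.
  by rewrite rowB; have := tq _ ix; move/tightP: ix => ->; lra.
set q' := x + e *: (q - x) => Pq'.
have tq' i : i \in tight x -> (M *m q) i 0 = b i 0 -> i \in tight q'.
  move=> /tightP ix iq; apply/tightP; rewrite rowD rowZ rowB ix iq; lra.
exists (2^-1 *: (x + q')), i0; rewrite tight_mid //; split=> //.
- exact: pol_mid.
- rewrite properE finset.subsetIl /=; apply/negP => /fintype.subsetP h.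
  have : min_face x q'.
    by split=> //; apply/fintype.subsetP => i /h; rewrite finset.in_setI => /andP[].
  rewrite xE => -[_ /=]; rewrite dotD dotZ dotB ax aq => h'.
  have : 0 < e * (c - (a *m w) 0 0) by rewrite mulr_gt0 // subr_gt0.
  lra.
- apply/fintype.subsetP => i iz; rewrite finset.in_setI zx //=. apply: (tq' _ (zx _ iz)).
  by rewrite rowD rowZ uz // mulr0 addr0; exact: tightP (zw _ iz).
by rewrite finset.in_setI i0x tq'.
Qed.

Definition covers F G := F `<` G /\
  forall K, is_face pol K -> F `<=` K -> K `<=` G -> K = F \/ K = G.

(** Above the empty face a cover is a vertex. Otherwise the directions of the larger face are shown
    to be spanned by those of the smaller one and the single vector [z - x]. *)
Lemma dim_covers F G : bounded_set pol -> is_face pol F -> is_face pol G ->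
  covers F G -> dim G <= dim F + 1.
Proof.
move=> bP fF fG [[FG nGF] cov].
have [F0|[x Px Fx]] := faceP fF.
  rewrite F0 dim_set0 addNr.
  have [z Gz] : G !=set0 by apply/set0P/eqP => G0; apply: nGF; rewrite G0.
  have [v [fv v0] [vz nv]] := vertex_avoiding bP face_set0 (face_subset fG Gz) id.
  have vG : v `<=` G by exact: subset_trans vz (min_face_sub fG Gz).
  have [|vF|<-] := cov v fv _ vG; first by rewrite F0.
    by case: nv; rewrite vF F0.
  by rewrite v0.
have [G0|[z Pz Gz]] := faceP fG; first by case: nGF; rewrite G0.
subst F G.
have [a [c [Pa xE]]] := fF.
have zx := (min_faceS z Px).1 FG.
have az : (a *m z) 0 0 < c.
  rewrite lt_neqAle Pa // andbT; apply/eqP => h; apply: nGF; apply: min_face_sub => //.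
  by rewrite xE.
have ax : (a *m x) 0 0 = c by have := min_face_refl Px; rewrite xE => -[].
have zxd : z - x \in dirs z by apply: dirs_min_face; [exact: min_face_refl|exact: FG].
have azx : (a *m (z - x)) 0 0 != 0 by rewrite dotB ax subr_eq0 lt_eqF.
rewrite !dim_min_face // -PoszD lez_nat.
have sub : (dirs z <= dirs x + <[z - x]>)%VS.
  (* Subtracting [s *: (z - x)] makes [a] vanish. If the rest were not in [dirs x], [cone_step]
     would give a face strictly between: its tight set is smaller than that of [x], but has an [i]
     not tight at [z], since the rest lies in [dirs z]. *)
  apply/subvP => u uz; pose s := (a *m u) 0 0 / (a *m (z - x)) 0 0.
  rewrite -[u](subrK (s *: (z - x))); apply: memv_add; last by rewrite memvZ ?memv_line.
  apply: contrapT => /negP nu.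
  have [] := cone_step Px Pa xE zx (min_face_refl Pz) az _ _ nu.
  - by rewrite memvB // memvZ.
  - by rewrite dotB dotZ divfK // subrr.
  move=> y [i [Py yx zy iy ui]].
  have [|||/(congr1 (fun F => F y)) E|/(congr1 (fun F => F z)) E] := cov (min_face y).
  - exact: min_face_face.
  - by apply/(min_faceS _ Px)/proper_sub.
  - by apply/(min_faceS _ Py).
  - have : min_face x y by rewrite -E.
    by move=> [_]; apply/negP; rewrite proper_subn.
  have [_ /fintype.subsetP/(_ _ iy) iz] : min_face y z by rewrite E.
  move: ui; suff -> : (M *m (u - s *: (z - x))) i 0 = 0 by rewrite ltxx.
  by have /dirsP -> : u - s *: (z - x) \in dirs z by rewrite memvB // memvZ.
apply: leq_trans (dimvS sub) _; apply: leq_trans (dimv_add_leqif _ _).1 _.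
by rewrite leq_add2l dim_vline leq_b1.
Qed.

Lemma hasse_arcP F G : bounded_set pol -> is_face pol F -> is_face pol G ->
  hasse_arc F G <-> covers F G.
Proof.
move=> bP fF fG; split=> [[FG dFG]|cov].
  split=> // K fK FK KG.
  have [KF|nKF] := pselect (K `<=` F); first by left; exact/seteqP.
  have [GK|nGK] := pselect (G `<=` K); first by right; exact/seteqP.
  have := dim_proper fF fK (conj FK nKF); have := dim_proper fK fG (conj KG nGK).
  by rewrite dFG; lia.
split; first by case: cov.
have := dim_covers bP fF fG cov; have := dim_proper fF fG cov.1; lia.
Qed.

(** Induction on the codimension: as long as [G] is not a facet, a strictly larger face that still
    misses [y] is produced. *)
Lemma facet_avoiding G y : bounded_set pol -> is_face pol G -> pol y -> ~ G y ->
  exists2 f, facets pol f & G `<=` f /\ ~ f y.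
Proof.
move=> bP + Py.
have [n] := ubnP `|dim pol - dim G|%N; elim: n G => // n IHn G; rewrite ltnS => Gn fG Gy.
have [dG|ndG] := eqVneq (dim G) (dim pol - 1); first by exists G; split.
have Gpol : G `<` pol by split; [exact: face_subset|move=> /(_ y Py)].
have dGpol := dim_proper fG face_setT Gpol.
suff [K [fK GK nKG Ky]] : exists K, [/\ is_face pol K, G `<=` K, ~ K `<=` G & ~ K y].
  have dK := dim_proper fG fK (conj GK nKG).
  have Kpol := dim_subset fK face_setT (face_subset fK).
  have [|f ff [Kf fy]] := IHn K _ fK Ky; first by lia.
  by exists f => //; split=> //; exact: subset_trans Kf.
have [G0|[x Px Gx]] := faceP fG.
  have dP : 0 < dim pol by move: ndG dGpol; rewrite G0 dim_set0; lia.
  (* At most one vertex contains [y]; as [dim pol] is positive there are two vertices, and one of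
     them misses [y]. *)
  have yv v : vertices pol v -> v y -> min_face y = v.
    move=> [fv v0] vy; apply/seteqP; split; first exact: min_face_sub.
    apply: contrapT => h; have := dim_proper (min_face_face y) fv (conj (min_face_sub fv vy) h).
    by rewrite v0 dim_min_face.
  have [v vv [_ v0]] := vertex_avoiding bP face_set0 Py id.
  have [vy|nvy] := pselect (v y); last by exists v; rewrite G0; split=> //; case: vv.
  have [z Pz nvz] : exists2 z, pol z & ~ v z.
    apply: contrapT => h; have : dim pol <= dim v.
      apply: dim_subset; [exact: face_setT|by case: vv|].
      by move=> z Pz; apply: contrapT => vz; apply: h; exists z.
    by case: vv => _ ->; rewrite leNgt dP.
  have [v' vv' [_ nv']] := vertex_avoiding bP vv.1 Pz nvz.
  exists v'; rewrite G0; split=> //; first by case: vv'.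
    by move=> v'0; apply: nv' => s /v'0.
  by move=> /(yv _ vv') v'y; apply: nv'; rewrite -v'y (yv _ vv).
have [/eqP polE|[z Pz polz]] := faceP face_setT; first by move: Py; rewrite (eqP polE).
(* Were there no face strictly between, [pol] would cover [G], and [dim_covers] would make [G] a
   facet. *)
have [K [fK [GK KP] nKG nKP]] : exists K,
    [/\ is_face pol K, G `<=` K /\ K `<=` pol, K <> G & K <> pol].
  apply: contrapT => h; have : dim pol <= dim G + 1.
    apply: dim_covers => //; first exact: face_setT.
    split=> // K fK GK KP; apply: contrapT => /not_orP[h1 h2].
    by apply: h; exists K.
  by move: ndG dGpol; lia.
have [Ky|nKy] := pselect (K y); last first.
  by exists K; split=> // KG; apply: nKG; exact/seteqP.
have [K0|[x' Px' Kx']] := faceP fK; first by move: Ky; rewrite K0.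
subst G K.
have [a [c [Pa xE]]] := fG.
have ac t : pol t -> ~ min_face x t -> (a *m t) 0 0 < c.
  move=> Pt nt; rewrite lt_neqAle Pa // andbT; apply/eqP => h; apply: nt.
  by rewrite xE.
have ay := ac _ Py Gy.
have nzx : ~ min_face x z.
  move=> h; case: Gpol => _; apply; rewrite {1}polz.
  exact: min_face_sub.
have az := ac _ Pz nzx.
have ax : (a *m x) 0 0 = c by have := min_face_refl Px; rewrite xE => -[].
have [i1 i1x' i1z] : exists2 i, i \in tight x' & i \notin tight z.
  apply: contrapT => h; apply: nKP; apply/seteqP; split=> //.
  rewrite {1}polz; apply/(min_faceS _ Pz)/fintype.subsetP => i ix'.
  by apply: contrapT => /negP iz; apply: h; exists i.
have i1x : i1 \in tight x by have := (min_faceS x' Px).1 GK; move/fintype.subsetP; apply.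
have i1y : i1 \in tight y by case: Ky => _ /fintype.subsetP; apply.
(* The coefficients make [a] vanish on [u]. On a constraint tight at [x] and [y] the second term
   contributes nothing and the first is nonpositive, even negative at [i1]; hence [u] is not in
   [dirs x]. *)
pose u := (c - (a *m y) 0 0) *: (z - x) - (c - (a *m z) 0 0) *: (y - x).
have ui i : i \in tight x -> i \in tight y ->
    (M *m u) i 0 = (c - (a *m y) 0 0) * ((M *m z) i 0 - b i 0).
  by move=> /tightP ix /tightP iy; rewrite rowB !rowZ !rowB ix iy; lra.
have uz : u \in dirs z.
  by rewrite memvB // memvZ // dirs_min_face // -polz.
have au : (a *m u) 0 0 = 0 by rewrite dotB !dotZ !dotB ax; lra.
have ux : u \notin dirs x.
  apply/negP => /dirsP/(_ _ i1x)/eqP; rewrite ui // mulf_eq0.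
  by rewrite gt_eqF ?subr_gt0 //= lt_eqF // subr_lt0 slack.
have zx : tight z \subset tight x by apply/(min_faceS _ Px); rewrite -polz; exact: face_subset.
have [y0 [i0 [Py0 y0x zy0 i0y0 i0u]]] :=
  cone_step Px Pa xE zx (min_face_refl Pz) az uz au ux.
exists (min_face y0); split.
- exact: min_face_face.
- by apply/(min_faceS _ Px)/proper_sub.
- by move=> /(min_faceS _ Py0); apply/negP; rewrite proper_subn.
(* The constraint [i0] increases along [u] and is tight at [x], so it cannot be tight at [y]: the
   face found misses [y]. *)
move=> [_ /fintype.subsetP/(_ _ i0y0) i0y].
have /fintype.subsetP/(_ _ i0y0) i0x := proper_sub y0x.
move: i0u; rewrite ui // ltNge => /negP; apply.
by rewrite mulr_ge0_le0 ?subr_ge0 ?subr_le0 ?(ltW ay) ?Pz.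
Qed.

End Polyhedron.

(** * Faces and closed sets *)


Section FaceLattice.
Variables (R : realType) (d m n : nat) (P : set 'cV[R]_d) (A : 'M[bool]_(m, n)).
Hypotheses (polyP : polytope P) (incA : vertex_facet_incidence P A).
Implicit Types F G H K : set 'cV[R]_d.

Lemma face_inter (I : finType) (D : {pred I}) (F : I -> set 'cV[R]_d) :
  (forall i, is_face P (F i)) -> is_face P (P `&` [set x | forall i, i \in D -> F i x]).
Proof. by case: polyP => [[k [M [b ->]]] _]; exact: face_bigcap. Qed.

Lemma vertex_sub F G : is_face P F ->
  (forall v, vertices P v -> v `<=` F -> v `<=` G) -> is_face P G -> F `<=` G.
Proof.
case: polyP => [[k [M [b PE]]] bP]; rewrite PE in bP * => fF FG fG x Fx.
apply: contrapT => Gx.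
have [v vP [vx nv]] := vertex_avoiding bP fG (face_subset fF Fx) Gx.
exact/nv/FG/(subset_trans vx)/(min_face_sub fF Fx).
Qed.

Lemma facet_sup F G : is_face P F -> is_face P G ->
  (forall f, facets P f -> G `<=` f -> F `<=` f) -> F `<=` G.
Proof.
case: polyP => [[k [M [b PE]]] bP]; rewrite PE in bP * => fF fG FG x Fx.
apply: contrapT => Gx.
have [f fP [Gf fx]] := facet_avoiding bP fG (face_subset fF Fx) Gx.
exact/fx/(FG _ fP Gf).
Qed.

Lemma hasse_arc_cover F G : is_face P F -> is_face P G ->
  hasse_arc F G <-> F `<` G /\
    forall K, is_face P K -> F `<=` K -> K `<=` G -> K = F \/ K = G.
Proof. by case: polyP => [[k [M [b ->]]] bP]; exact: hasse_arcP. Qed.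

(** By [hasse_arc_cover] arcs are covers in the inclusion order, and order isomorphisms preserve
    covers. *)
Lemma closed_cover_arc r c (B : 'M[bool]_(r, c)) (Phi : {set 'I_c} -> set 'cV[R]_d) :
  set_bij [set S | closed_set B S] (faces P) Phi ->
  (forall S T, closed_set B S -> closed_set B T -> (Phi S `<=` Phi T <-> S \subset T)) ->
  forall S T, closed_set B S -> closed_set B T ->
    (hasse_arc (Phi S) (Phi T) <-> closed_cover B S T).
Proof.
move=> [fP inj surj] sub S T cS cT.
have fS := fP _ cS; have fT := fP _ cT.
apply: iff_trans (hasse_arc_cover fS fT) _.
split=> [[[ST TS] h]|[]]; last rewrite properE => /andP[ST /negP TS] h.
- split=> [|U cU SU UT].
    by rewrite properE ((sub _ _ _ _).1 ST) //; apply/negP => /(sub _ _ cT cS).2.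
  have [|||/inj E|/inj E] := h (Phi U).
  + exact: fP.
  + exact/sub.
  + exact/sub.
  + by left; apply: E; rewrite inE.
  + by right; apply: E; rewrite inE.
- split; first by split; [exact/sub|move=> /(sub _ _ cT cS)].
  move=> _ /surj[U /= cU <-] /(sub _ _ cS cU) SU /(sub _ _ cU cT) UT.
  by have [//|//|//|->|->] := h U; [left|right].
Qed.

Lemma closed_cover_coarc r c (B : 'M[bool]_(r, c)) (Phi : {set 'I_c} -> set 'cV[R]_d) :
  set_bij [set S | closed_set B S] (faces P) Phi ->
  (forall S T, closed_set B S -> closed_set B T -> (Phi T `<=` Phi S <-> S \subset T)) ->
  forall S T, closed_set B S -> closed_set B T ->
    (hasse_arc (Phi T) (Phi S) <-> closed_cover B S T).
Proof.
move=> [fP inj surj] sub S T cS cT.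
have fS := fP _ cS; have fT := fP _ cT.
apply: iff_trans (hasse_arc_cover fT fS) _.
split=> [[[ST TS] h]|[]]; last rewrite properE => /andP[ST /negP TS] h.
- split=> [|U cU SU UT].
    by rewrite properE ((sub _ _ _ _).1 ST) //; apply/negP => /(sub _ _ cT cS).2.
  have [|||/inj E|/inj E] := h (Phi U).
  + exact: fP.
  + exact/sub.
  + exact/sub.
  + by right; apply: E; rewrite inE.
  + by left; apply: E; rewrite inE.
- split; first by split; [exact/sub|move=> /(sub _ _ cT cS)].
  move=> _ /surj[U /= cU <-] /(sub _ _ cU cT) UT /(sub _ _ cS cU) SU.
  by have [//|//|//|->|->] := h U; [right|left].
Qed.

(** The inverse [V] of [Phi] takes a face to its vertices. That [V F] is closed rests on
    [facet_sup]; that [F] is recovered from [V F] rests on [vertex_sub]. *)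
Lemma face_lattice_vertices : exists Phi : {set 'I_n} -> set 'cV[R]_d,
  set_bij [set S | closed_set A S] (faces P) Phi /\
  forall S T, closed_set A S -> closed_set A T ->
    (hasse_arc (Phi S) (Phi T) <-> closed_cover A S T).
Proof.
have [fac [vert [[facP facI facS] [vertP vertI vertS] AP]]] := incA.
have fF f : is_face P (fac f) by have [] : facets P (fac f) by exact: facP.
have vF v : is_face P (vert v) by have [] : vertices P (vert v) by exact: vertP.
pose V F : {set 'I_n} := [set v | `[< vert v `<=` F >]]%SET.
have VP F v : v \in V F <-> vert v `<=` F by rewrite inE; split; [move/asboolP|move=> ?; exact/asboolP].
have Vsub F G : is_face P F -> is_face P G -> (V F \subset V G <-> F `<=` G).
  move=> fF' fG; split=> [/fintype.subsetP VFG|FG]; last first.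
    by apply/fintype.subsetP => v /VP vF'; apply/VP; exact: subset_trans vF' FG.
  by apply: (vertex_sub fF' _ fG) => _ /vertS[v _ <-] /VP/VFG/VP.
have Vcl F : is_face P F -> closed_set A (V F).
  move=> fF'; rewrite /closed_set finset.eqEsubset sub_cl andbT; apply/fintype.subsetP => w /clP h.
  apply/VP; apply: (facet_sup (vF w) fF') => _ /facS[f _ <-] Ff.
  by apply/AP/h/in_rowP => u /VP uF; apply/AP; exact: subset_trans uF Ff.
(* Intersecting with [P] covers the sets contained in no row, for which no facet restricts the
   points. *)
pose Phi S := P `&` [set x | forall f, f \in [pred f | in_row A f S] -> fac f x].
have PhiF S : is_face P (Phi S) by exact: face_inter.
have VK S : closed_set A S -> V (Phi S) = S.
  move=> /eqP cS; rewrite -[RHS]cS; apply/finset.setP => v; apply/idP/clP.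
    by move=> /VP vS f fS; apply/AP => x /vS[_ /(_ f fS)].
  move=> h; apply/VP => x vx; split; last by move=> f /h/AP; apply.
  by have [a [c [_ E]]] := vF v; move: vx; rewrite E => -[].
have bij : set_bij [set S | closed_set A S] (faces P) Phi.
  split=> [S _|S T|F fF'].
  - exact: PhiF.
  - by rewrite !inE => cS cT E; rewrite -[LHS]VK // E VK.
  - exists (V F); first exact: Vcl.
    have E := VK _ (Vcl _ fF').
    by apply/seteqP; split; apply/Vsub => //; rewrite E.
exists Phi; split=> //; apply: closed_cover_arc => // S T cS cT.
by have := Vsub _ _ (PhiF S) (PhiF T); rewrite !VK // => ->.
Qed.

(** Dual to the previous bijection, with [vertex_sub] and [facet_sup] exchanging roles; larger sets
    of facets give smaller faces, whence the reversed arcs. *)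
Lemma face_lattice_facets : exists Phi : {set 'I_m} -> set 'cV[R]_d,
  set_bij [set S | closed_set A^T S] (faces P) Phi /\
  forall S T, closed_set A^T S -> closed_set A^T T ->
    (hasse_arc (Phi T) (Phi S) <-> closed_cover A^T S T).
Proof.
have [fac [vert [[facP facI facS] [vertP vertI vertS] AP]]] := incA.
have fF f : is_face P (fac f) by have [] : facets P (fac f) by exact: facP.
have vF v : is_face P (vert v) by have [] : vertices P (vert v) by exact: vertP.
pose V F : {set 'I_m} := [set f | `[< F `<=` fac f >]]%SET.
have VP F f : f \in V F <-> F `<=` fac f by rewrite inE; split; [move/asboolP|move=> ?; exact/asboolP].
have Vsub F G : is_face P F -> is_face P G -> (V F \subset V G <-> G `<=` F).
  move=> fF' fG; split=> [/fintype.subsetP VFG|FG]; last first.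
    by apply/fintype.subsetP => v /VP vF'; apply/VP; exact: subset_trans FG vF'.
  by apply: (facet_sup fG fF') => _ /facS[v _ <-] /VP/VFG/VP.
have Vcl F : is_face P F -> closed_set A^T (V F).
  move=> fF'; rewrite /closed_set finset.eqEsubset sub_cl andbT; apply/fintype.subsetP => g /clP h.
  apply/VP; apply: (vertex_sub fF' _ (fF g)) => _ /vertS[v _ <-] vF'.
  have := h v; rewrite mxE => hv; apply/AP/hv/in_rowP => f /VP Ff.
  by rewrite mxE; apply/AP; exact: subset_trans vF' Ff.
pose Phi (S : {set 'I_m}) := P `&` [set x | forall f, f \in S -> fac f x].
have PhiF S : is_face P (Phi S) by exact: face_inter.
have VK S : closed_set A^T S -> V (Phi S) = S.
  move=> /eqP cS; rewrite -[RHS]cS; apply/finset.setP => g; apply/idP/clP.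
    move=> /VP vS v /in_rowP fS; rewrite mxE; apply/AP.
    apply: subset_trans vS => x vx; split.
      by have [a [c [_ E]]] := vF v; move: vx; rewrite E => -[].
    by move=> f /fS; rewrite mxE => /AP; apply.
  move=> h; apply/VP; apply: (vertex_sub (PhiF S) _ (fF g)) => _ /vertS[v _ <-] vS; apply/AP.
  rewrite -[A g v]/(A g v); have := h v; rewrite mxE; apply; apply/in_rowP => f fS.
  by rewrite mxE; apply/AP => x /vS[_]; exact.
have bij : set_bij [set S | closed_set A^T S] (faces P) Phi.
  split=> [S _|S T|F fF'].
  - exact: PhiF.
  - by rewrite !inE => cS cT E; rewrite -[LHS]VK // E VK.
  - exists (V F); first exact: Vcl.
    have E := VK _ (Vcl _ fF').
    by apply/seteqP; split; apply/Vsub => //; rewrite E.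
exists Phi; split=> //; apply: closed_cover_coarc => // S T cS cT.
by have := Vsub _ _ (PhiF S) (PhiF T); rewrite !VK // => ->.
Qed.


Lemma face_proper_dim F G : is_face P F -> is_face P G -> F `<=` G -> dim F = dim G -> F = G.
Proof.
case: polyP => [[k [M [b PE]]] bP]; rewrite PE => fF fG FG dFG.
apply/seteqP; split=> //; apply: contrapT => nGF.
by have := dim_proper fF fG (conj FG nGF); rewrite dFG ltxx.
Qed.

Lemma face_self : is_face P P.
Proof. by case: polyP => [[k [M [b ->]]] _]; exact: face_setT. Qed.

Lemma face_empty : is_face P set0.
Proof. by case: polyP => [[k [M [b ->]]] _]; exact: face_set0. Qed.

Lemma face_sub F : is_face P F -> F `<=` P.
Proof. by move=> [a [c [_ ->]]] x []. Qed.

Lemma face_dim_lt0 F : is_face P F -> dim F < 0 -> F = set0.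
Proof.
case: polyP => [[k [M [b PE]]] bP]; rewrite PE => fF dF.
by apply/eqP/negPn/negP => /set0P/(dim_face_ge0 fF); rewrite leNgt dF.
Qed.

(** A vertex on every facet would, by [facet_sup], lie in the empty face, against its dimension. *)
Lemma closed_set0_vertices : closed_set A finset.set0.
Proof.
have [fac [vert [[facP facI facS] [vertP vertI vertS] AP]]] := incA.
rewrite /closed_set -finset.subset0; apply/fintype.subsetP => v /clP h.
have vv : vertices P (vert v) by exact: vertP.
have : vert v `<=` set0.
  apply: (facet_sup vv.1 face_empty) => _ /facS[f _ <-] _.
  by apply/AP/h/in_rowP => u; rewrite inE.
by rewrite subset0 => v0; have := vv.2; rewrite v0 dim_set0.
Qed.

(** A facet through every vertex would, by [vertex_sub], be all of [P], against its dimension. *)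
Lemma closed_set0_facets : closed_set A^T finset.set0.
Proof.
have [fac [vert [[facP facI facS] [vertP vertI vertS] AP]]] := incA.
rewrite /closed_set -finset.subset0; apply/fintype.subsetP => f /clP h.
have ff : facets P (fac f) by exact: facP.
have Pf : P `<=` fac f.
  apply: (vertex_sub face_self _ ff.1) => _ /vertS[v _ <-] _.
  by have := h v; rewrite mxE => hv; apply/AP/hv/in_rowP => u; rewrite inE.
have E : P = fac f by apply/seteqP; split=> //; exact: face_sub ff.1.
by have := ff.2; rewrite -E; lia.
Qed.

(** A facet without vertices is empty, and a vertex on no facet is all of [P]; either forces
    [dim P = 0]. In that dimension the only facet is empty and the only vertex is [P]. *)
Lemma nincidences_bounds :
  (m <= nincidences A)%N /\ (n <= nincidences A)%N \/ (m <= 1)%N /\ (n <= 1)%N.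
Proof.
have [fac [vert [[facP facI facS] [vertP vertI vertS] AP]]] := incA.
have ff f : facets P (fac f) by exact: facP.
have vv v : vertices P (vert v) by exact: vertP.
have le1 p (g : 'I_p -> set 'cV[R]_d) : set_inj [set: 'I_p] g -> (forall i j, g i = g j) -> (p <= 1)%N.
  move=> gI gE; case: p g gI gE => [//|[//|p]] g gI gE.
  by have := gI ord0 ord_max; rewrite !inE => /(_ I I (gE _ _)).
have [dP|dP] := eqVneq (dim P) 0; [right|left].
  split.
    apply: (le1 _ _ facI) => i j.
    have E f : fac f = set0 by apply: (face_dim_lt0 (ff f).1); rewrite (ff f).2 dP.
    by rewrite !E.
  apply: (le1 _ _ vertI) => i j.
  suff E v : vert v = P by rewrite !E.
  by apply: (face_proper_dim (vv v).1 face_self (face_sub (vv v).1)); rewrite dP (vv v).2.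
have fv f : exists v, A f v.
  apply: contrapT => /forallNP h; apply/negP: dP; apply/negPn/eqP.
  have : fac f `<=` set0.
    by apply: (vertex_sub (ff f).1 _ face_empty) => _ /vertS[v _ <-] /AP/h.
  by rewrite subset0 => f0; have := (ff f).2; rewrite f0 dim_set0; lia.
have vf v : exists f, A f v.
  apply: contrapT => /forallNP h; apply/negP: dP; apply/negPn/eqP.
  have Pv : P `<=` vert v.
    by apply: (facet_sup face_self (vv v).1) => _ /facS[f _ <-] /AP/h.
  rewrite -(vv v).2; congr dim; apply/seteqP; split=> //; exact: face_sub (vv v).1.
rewrite /nincidences; split.
  rewrite -[X in (X <= _)%N]card_ord -sum1_card leq_sum // => f _.
  by have [v fv1] := fv f; rewrite (bigD1 v) //= fv1.
rewrite exchange_big -[X in (X <= _)%N]card_ord -sum1_card leq_sum // => v _.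
by have [f fv1] := vf v; rewrite (bigD1 f) //= fv1.
Qed.


(** The bijection also supplies the finiteness of the set of faces, without which [fset_set] would
    be empty by default. *)
Lemma nfaces_closed_sets r c (B : 'M[bool]_(r, c)) (Phi : {set 'I_c} -> set 'cV[R]_d) :
  set_bij [set S | closed_set B S] (faces P) Phi ->
  nfaces P = #|[pred S | closed_set B S]|.
Proof.
move=> [PhiP PhiI PhiS]; apply: card_fset_set; apply: card_esym.
set s := enum [pred S | closed_set B S].
have sE : size s = #|[pred S | closed_set B S]| by rewrite -cardE.
apply/card_set_bijP; exists (fun i => Phi (nth finset.set0 s i)); split.
- move=> i /=; rewrite -sE => /(mem_nth finset.set0); rewrite mem_enum inE => ci.
  exact: PhiP.
- move=> i j; rewrite !inE /= -sE => si sj /PhiI E; apply/eqP.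
  rewrite -(nth_uniq finset.set0 si sj (enum_uniq _)); apply/eqP/E; rewrite inE /=.
    by have := mem_nth finset.set0 si; rewrite mem_enum.
  by have := mem_nth finset.set0 sj; rewrite mem_enum.
move=> _ /PhiS[S cS <-].
have Ss : S \in s by rewrite mem_enum.
by exists (index S s); rewrite ?nth_index //= -sE index_mem.
Qed.

Lemma leq_nfaces : (m <= nfaces P)%N /\ (n <= nfaces P)%N.
Proof.
have [fac [vert [[facP facI facS] [vertP vertI vertS] AP]]] := incA.
have [Phi [bij _]] := face_lattice_vertices.
rewrite (nfaces_closed_sets bij); case: bij => PhiP PhiI PhiS.
have le p (g : 'I_p -> set 'cV[R]_d) : set_inj [set: 'I_p] g -> (forall i, is_face P (g i)) ->
    (p <= #|[pred S | closed_set A S]|)%N.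
  move=> gI gF.
  have hex i : exists S, closed_set A S /\ Phi S = g i.
    by have [S cS E] := PhiS _ (gF i); exists S.
  have [h hP] := choice hex.
  have hI : injective h.
    by move=> i j E; apply: gI; rewrite ?inE // -(hP i).2 -(hP j).2 E.
  rewrite -[p]card_ord -(card_codom hI); apply: subset_leq_card.
  by apply/fintype.subsetP => _ /codomP[i ->]; rewrite inE (hP i).1.
split; first by apply: le facI _ => f; have [] : facets P (fac f) by exact: facP.
by apply: le vertI _ => v; have [] : vertices P (vert v) by exact: vertP.
Qed.

End FaceLattice.

(** * From the output to the Hasse diagram *)

Lemma mul_addr_lt m n (i : 'I_m) (j : 'I_n) : (i * n + j < m * n)%N.
Proof.
apply: (@leq_trans (i.+1 * n)); first by rewrite mulSn addnC ltn_add2r.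
by rewrite leq_mul2r ltn_ord orbT.
Qed.

Section Correctness.
Variables (R : realType) (d m n : nat) (P : set 'cV[R]_d) (A : 'M[bool]_(m, n)).
Hypotheses (polyP : polytope P) (incA : vertex_facet_incidence P A).

Lemma hasse_diagram_arcs_out r c (B : 'M[bool]_(r, c)) (dir : bool)
    (Phi : {set 'I_c} -> set 'cV[R]_d) st q :
  set_bij [set S | closed_set B S] (faces P) Phi ->
  (forall S T, closed_set B S -> closed_set B T ->
    (if dir then hasse_arc (Phi T) (Phi S) else hasse_arc (Phi S) (Phi T)) <->
    closed_cover B S T) ->
  explored B q 0 st -> size st.1 = q ->
  exists N (arcs : seq ('I_N * 'I_N)),
    rcons (arcs_out dir st.2) q = encode_digraph arcs /\ is_hasse_diagram P arcs.
Proof.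
move=> [PhiP PhiI PhiS] cov ex sq.
have mem_arcs := explored_arcs _ _ ex sq; have closed_in := explored_closed ex sq.
case: st => Ss arcs in ex sq mem_arcs closed_in *.
case: ex => -[uS S0] cS uA _ _.
(* The number of nodes is positive because the empty set is listed; this makes [inord] available for
   the recorded indices. *)
case: q sq mem_arcs => [/size0nil E _|N /= sq mem_arcs]; first by move: S0; rewrite [Ss]E in_nil.
pose o (a : nat * nat) : 'I_N.+1 * 'I_N.+1 :=
  if dir then (inord a.2, inord a.1) else (inord a.1, inord a.2).
have aN a : a \in arcs -> (a.1 < N.+1 /\ a.2 < N.+1)%N.
  by case: a => i j /mem_arcs[].
exists N.+1, (map o arcs); split.
  rewrite /encode_digraph /arcs_out -map_comp; congr (rcons (flatten _) _).
  apply/eq_in_map => -[i j] /aN[/= iN jN]; rewrite /o /=; case: (dir); by rewrite /= !inordK.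
have face_closed (i : 'I_N.+1) : closed_set B (nth finset.set0 Ss i).
  by apply: cS; apply: mem_nth; rewrite sq.
have oE (i j : 'I_N.+1) : ((i, j) \in map o arcs) = ((if dir then (val j, val i) else (val i, val j)) \in arcs).
  apply/mapP/idP => [[[i' j'] ija]|ija].
    have [/= iN jN] := aN _ ija; rewrite /o /=.
    by case: (dir) => -[-> ->]; rewrite !inordK.
  exists (if dir then (val j, val i) else (val i, val j)) => //.
  by rewrite /o; case: (dir); rewrite /= !inord_val.
split.
  rewrite map_inj_in_uniq // => -[i j] [i' j'] /aN[/= iN jN] /aN[/= iN' jN'].
  by rewrite /o /=; case: (dir) => -[/(congr1 val) + /(congr1 val)]; rewrite /= !inordK // => -> ->.
exists (fun i => Phi (nth finset.set0 Ss i)); split.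
  split=> [i _|i j _ _ /PhiI E|F /PhiS[S cSS <-]].
  - exact: PhiP (face_closed i).
  - have lt (k : 'I_N.+1) : (k < size Ss)%N by rewrite sq.
    have /eqP := E (mem_set (face_closed i)) (mem_set (face_closed j)).
    by rewrite (nth_uniq _ (lt i) (lt j) uS) => /eqP/val_inj.
  - have SS : S \in Ss by exact: closed_in.
    have iN : (index S Ss < N.+1)%N by rewrite -sq index_mem.
    by exists (Ordinal iN); rewrite //= nth_index.
move=> i j; rewrite oE; case: (dir) cov => cov.
  apply: iff_trans (iff_sym (cov _ _ (face_closed j) (face_closed i))).
  split=> [/mem_arcs[]//|h]; apply/mem_arcs; split; [exact: ltn_ord|exact: ltn_ord|exact: h].
apply: iff_trans (iff_sym (cov _ _ (face_closed i) (face_closed j))).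
split=> [/mem_arcs[]//|h]; apply/mem_arcs; split; [exact: ltn_ord|exact: ltn_ord|exact: h].
Qed.

Lemma nincidences_trmx : nincidences A = nones A^T.
Proof.
rewrite /nincidences /nones exchange_big; apply: eq_bigr => v _; apply: eq_bigr => f _.
by rewrite mxE.
Qed.

(** Both orientations at once: [B] is the matrix as read with the strides [sr] and [sc], and [dir]
    tells whether inclusion of closed sets reverses that of faces. *)
Lemma exec_hasse r c (B : 'M[bool]_(r, c)) sr sc (dir : bool) (Phi : {set 'I_c} -> set 'cV[R]_d) :
  set_bij [set S | closed_set B S] (faces P) Phi ->
  (forall S T, closed_set B S -> closed_set B T ->
    (if dir then hasse_arc (Phi T) (Phi S) else hasse_arc (Phi S) (Phi T)) <->
    closed_cover B S T) ->
  (if dir then [/\ (m < n)%N, r = n, c = m, sr = 1%N & sc = n]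
   else [/\ (n <= m)%N, r = m, c = n, sr = n & sc = 1%N]) ->
  (forall (f : 'I_r) (v : 'I_c), (f * sr + v * sc < r * c)%N) ->
  entries B sr sc (memory (input_state A)) ->
  closed_set B finset.set0 -> nincidences A = nones B ->
  exists (t b : nat) (s : state) (N : nat) (arcs : seq ('I_N * 'I_N)),
    [/\ exec hasse_prog (input_state A) t b s, output s = encode_digraph arcs,
      is_hasse_diagram P arcs,
      (t <= 2000 * maxn 1 (minn n m * nincidences A * nfaces P))%N &
      (b <= 2000 * maxn 1 (nfaces P * minn n m))%N].
Proof.
move=> bij cov dirE addr em c0 nE.
have phiE := nfaces_closed_sets bij.
have cE : minn n m = c by case: (dir) dirE => -[nm _ -> _ _]; [apply/minn_idPr/ltnW|apply/minn_idPl].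
have [mphi nphi] := leq_nfaces polyP incA.
have c_phi : (c <= nfaces P)%N by rewrite -cE; exact: leq_trans (geq_minl _ _) nphi.
have [r_phi cr rc] : [/\ (r <= nfaces P)%N, (c <= r)%N & (r * c = m * n)%N].
  by case: (dir) dirE => -[nm -> -> _ _]; split=> //; [exact: ltnW|exact: mulnC].
have nr : (r <= nones B \/ r <= 1)%N.
  rewrite -nE; have := nincidences_bounds polyP incA.
  by case: (dir) dirE => -[_ -> _ _ _] [[h1 h2]|[h1 h2]]; [left|right|left|right].
pose W := (mem_size r c (nfaces P) + r + c + 4)%N.
have sizeW : (mem_size r c (nfaces P) + r + c + 4 <= 2 ^ W)%N by exact/ltnW/ltn_expl.
have cW : (c < W)%N by rewrite /W; lia.
have mem2 : size (memory (input_state A)) = (2 + r * c)%N by rewrite size_input rc.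
have fs : fits W (mem_size r c (nfaces P)) (cell_bound r c W) (input_state A).
  split=> //.
  - by move=> k; rewrite nth_nil expn_gt0.
  - by rewrite mem2 /mem_size /tree_base /pair_base -!addnA !leq_add2l leq_addr.
  move=> a; have [a2|a2] := ltnP a 2; last first.
    have [atb|atb] := ltnP a (tree_base r c).
      by rewrite /cell_bound [(a < 2)%N]ltnNge a2 atb /= ltnS; exact: input_le1.
    by rewrite nth_default ?expn_gt0 // mem2; apply: leq_trans atb; exact: leq_addr.
  rewrite /cell_bound a2; apply: leq_trans sizeW.
  have mn_rc : (m <= r + c /\ n <= r + c)%N by case: (dir) dirE => -[_ -> -> _ _]; lia.
  by case: a a2 => [|[|a]] //= _; lia.
have [|t [b [s [ex tT bB _ [st [q [exq sq outE]]]]]]] :=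
    @runs_hasse _ _ B sr sc _ W dir addr cW sizeW phiE c0 m n (memory (input_state A)) erefl erefl dirE em _ fs.
  by move=> a; rewrite nth_default // mem2 /tree_base /pair_base; lia.
have [N [arcs [encE hd]]] := hasse_diagram_arcs_out bij cov exq sq.
exists t, b, s, N, arcs; split=> //.
- by rewrite outE.
- by rewrite cE nE; apply: leq_trans tT _; exact: (total_time_le phiE c_phi r_phi cr nr).
by rewrite cE; apply: leq_trans bB _; exact: (space_le phiE c_phi r_phi cr nr).
Qed.

End Correctness.

Theorem theorem1 :
  exists (p : prog) (c : nat),
    forall (R : realType) (d : nat) (P : set 'cV[R]_d) (m n : nat)
           (A : 'M[bool]_(m, n)),
      polytope P -> vertex_facet_incidence P A ->
      exists (t b : nat) (s : state) (N : nat) (arcs : seq ('I_N * 'I_N)),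
        [/\ exec p (input_state A) t b s,
            output s = encode_digraph arcs,
            is_hasse_diagram P arcs,
            (t <= c * maxn 1 (minn n m * nincidences A * nfaces P))%N &
            (b <= c * maxn 1 (nfaces P * minn n m))%N].
Proof.
exists hasse_prog, 2000%N => R d P m n A polyP incA.
(* The smaller side supplies the columns. If [n <= m], the matrix is read as it stands; otherwise
   exchanging the strides presents its transpose. *)
have [nm|mn] := boolP (n <= m)%N.
  have [Phi [bij cov]] := face_lattice_vertices polyP incA.
  apply: (exec_hasse polyP incA (sr := n) (sc := 1%N) (dir := false) bij cov) => //.
  - by move=> f v; rewrite muln1; exact: mul_addr_lt.
  - by move=> f v; rewrite muln1 nth_input.
  - exact: closed_set0_vertices incA.
rewrite -ltnNge in mn.
have [Phi [bij cov]] := face_lattice_facets polyP incA.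
apply: (exec_hasse polyP incA (sr := 1%N) (sc := n) (dir := true) bij cov) => //.
- by move=> v f; rewrite muln1 addnC [(n * m)%N]mulnC; exact: mul_addr_lt.
- by move=> v f; rewrite muln1 [(v + f * n)%N]addnC nth_input mxE.
- exact: closed_set0_facets incA.
exact: nincidences_trmx.
Qed.
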